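(* Let $\epsilon \le 1/16$. Consider the $(6,3)$-majority algorithm run by $n$ nodes against a late $\epsilon$-bounded adaptive blocking adversary, starting from any initial assignment of values in $\{0,1\}$ to the nodes in which no node is undefined. Then $O(\log n)$ rounds suffice to ensure that, with high probability, all except a constant fraction of the nodes hold the same value.
   Context: Model: $n$ anonymous nodes, every pair of which can communicate directly, operate in synchronous rounds; in each round every node first receives all messages sent to it in the previous round that were not blocked, then performs arbitrary local computation, then sends messages. A late $\epsilon$-bounded adaptive adversary (with unlimited computational power): at the start of each round $t\ge 2$ it observes the complete state of the system at the beginning of round $t-1$, and based on this chooses a set $B_t$ of at most $\epsilon n$ nodes to block in round $t$; a blocked node can neither send nor receive messages in that round, and a node knows whether it is currently blocked. In round 1 the adversary knows the initial state but not the random choices made by the nodes in that round. ''With high probability'' (w.h.p.) means with probability at least $1-n^{-\Omega(1)}$. The $(k,\ell)$-majority algorithm (integers $k\ge \ell>0$, $\ell$ odd): each node $u$ has a variable $x_u\in\{0,1,\bot\}$; $u$ is undefined if $x_u=\bot$ and defined otherwise. In each round every node $u$ acts as follows. Reset rule: if $u$ received fewer than $\ell$ values from the previous round, or $u$ is blocked, then $u$ sets $x_u:=\bot$ and skips the rest of the round. Update rule: otherwise $u$ picks $\ell$ of the received values uniformly at random, sets $x_u$ to the majority of these $\ell$ values, and sends $x_u$ to $k$ nodes chosen independently and uniformly at random. *)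

(* Defs.v *)
From HB Require Import structures.
From mathcomp Require Import all_boot all_order all_algebra.
From mathcomp Require Import reals exp.
Set Implicit Arguments. Unset Strict Implicit. Unset Printing Implicit Defensive.
Import Order.TTheory GRing.Theory Num.Theory.
Local Open Scope ring_scope.

Section Model.
Variable R : realType.

Definition dist (A : Type) := seq (R * A).
Definition dret (A : Type) (a : A) : dist A := [:: (1, a)].
Definition dbind (A B : Type) (d : dist A) (f : A -> dist B) : dist B :=
  flatten [seq [seq (pw.1 * qy.1, qy.2) | qy <- f pw.2] | pw <- d].
Definition duniform (A : Type) (s : seq A) : dist A :=
  [seq (1 / (size s)%:R, x) | x <- s].
Definition prob (A : Type) (d : dist A) (P : A -> bool) : R :=
  \sum_(pw <- d) (if P pw.2 then pw.1 else 0).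

Fixpoint dseq (A : Type) (l : seq (dist A)) : dist (seq A) :=
  match l with
  | [::] => dret [::]
  | d :: l' => dbind d (fun a => dbind (dseq l') (fun r => dret (a :: r)))
  end.

Definition majority (s : seq bool) : bool := (size s < 2 * count id s)%N.

(** A configuration at the beginning of a round: the variable x_u of each
    node (None = undefined, bottom) and the multiset (as a list) of values
    received by u, i.e. sent to u in the previous round. *)
Definition config (n : nat) : Type := ('I_n -> option bool) * ('I_n -> seq bool).

(** Action of a node in one round of the (k,l)-majority algorithm:
    new value and list of the k targets it sends its value to. *)
Definition node_step (n k l : nat) (blocked : bool) (inbox : seq bool)
  : dist (option bool * seq 'I_n) :=
  if blocked || (size inbox < l)%N then dret (None, [::])
  else dbind (duniform (enum [set S : {set 'I_(size inbox)} | #|S| == l]))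
         (fun S => let v := majority [seq nth false inbox (nat_of_ord i) | i in S] in
            dbind (duniform (enum {: k.-tuple 'I_n}))
              (fun ts => dret (Some v, val ts))).

(** Assemble the next configuration from the per-node outcomes
    (listed in the order of enum 'I_n). Only defined nodes send. *)
Definition assemble (n : nat) (r : seq (option bool * seq 'I_n)) : config n :=
  (fun u : 'I_n => (nth (None, [::]) r u).1,
   fun v => flatten [seq match (nth (None, [::]) r u).1 with
                         | Some b => [seq b | t <- (nth (None, [::]) r u).2 & t == v]
                         | None => [::]
                         end | u : 'I_n <- enum 'I_n]).

Definition round (n k l : nat) (B : {set 'I_n}) (c : config n) : dist (config n) :=
  dbind (dseq [seq @node_step n k l (u \in B) (c.2 u) | u <- enum 'I_n])
        (fun r => dret (assemble r)).

(** Initial configuration: every node holds its initial value x0 u and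
    (as if it had just updated) sends it to k uniformly random nodes. *)
Definition init_config (n k : nat) (x0 : 'I_n -> bool) : dist (config n) :=
  dbind (dseq [seq dbind (duniform (enum {: k.-tuple 'I_n}))
                      (fun ts => dret (Some (x0 u), val ts)) | u <- enum 'I_n])
        (fun r => dret (assemble r)).

(** A late adaptive adversary: the blocked set of round t is a function of
    the configurations at the beginning of rounds 1, ..., t-1. *)
Definition adversary (n : nat) := seq (config n) -> {set 'I_n}.

Definition eps_bounded (n : nat) (eps : R) (adv : adversary n) : Prop :=
  forall h, (#|adv h|%:R : R) <= eps * n%:R.

Fixpoint run (n k l : nat) (adv : adversary n) (T : nat) (hist : seq (config n))
  (c : config n) : dist (config n) :=
  match T with
  | 0%N => dret c
  | T'.+1 => dbind (round k l (adv hist) c) (fun c' => run k l adv T' (rcons hist c) c')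
  end.

Definition process (n k l : nat) (adv : adversary n) (x0 : 'I_n -> bool) (T : nat)
  : dist (config n) :=
  dbind (init_config k x0) (fun c1 => run k l adv T [::] c1).

Definition almost_agree (n : nat) (gamma : R) (c : config n) : bool :=
  [exists b : bool, (1 - gamma) * n%:R <= (#|[set u | c.1 u == Some b]|%:R : R)].

End Model.

(* Main.v *)
Require Import Defs.
From mathcomp Require Import all_boot all_order all_algebra.
From mathcomp Require Import reals exp sequences.
From mathcomp Require Import zify ring lra.
Set Implicit Arguments. Unset Strict Implicit. Unset Printing Implicit Defensive.
Import Order.TTheory GRing.Theory Num.Theory.
Local Open Scope ring_scope.

(** Let the bias be the number of ones minus the number of zeros. The adversary fixes
    the blocked set before the messages are thrown into independent uniform inboxes,
    so by exchangeability of the messages the mean of the next bias is that of a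
    majority of three messages drawn from all of them; it exceeds the old bias by a
    factor 11/10, up to bias 2n/5, as long as 2n/3 nodes are defined. Bounded
    differences give the bias a variance O(n) and a fourth central moment O(n^2),
    and the inboxes with two ones and two zeros give it a variance of order at
    least n. Hence the potential 1 / (1 + slope * bias^2 / n) contracts in
    expectation by a constant factor per round: near bias 0 because of the noise,
    elsewhere because of the drift. Once the absolute bias is at least 2n/5 it stays
    so by the fourth moment bound, and 2n/3 nodes stay defined by Chebyshev's
    inequality. *)

Section Expectation.
Variable R : realType.
Implicit Types A B I : Type.

Definition expect A (d : dist R A) (f : A -> R) : R := \sum_(pw <- d) pw.1 * f pw.2.

Definition is_distr A (d : dist R A) : Prop :=
  all (fun pw => 0 <= pw.1) d /\ \sum_(pw <- d) pw.1 = 1.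

Lemma eq_expect A (d : dist R A) f g : f =1 g -> expect d f = expect d g.
Proof. by move=> fg; apply: eq_bigr => pw _; rewrite fg. Qed.

Lemma expect_ret A (a : A) f : expect (dret R a) f = f a.
Proof. by rewrite /expect /dret big_seq1 mul1r. Qed.

Lemma expect_bind A B (d : dist R A) (k : A -> dist R B) f :
  expect (dbind d k) f = expect d (fun a => expect (k a) f).
Proof.
rewrite /expect /dbind big_flatten big_map; apply: eq_bigr => pw _.
by rewrite big_map mulr_sumr; apply: eq_bigr => qy _ /=; rewrite mulrA.
Qed.

Lemma expect_uniform A (s : seq A) f :
  expect (duniform R s) f = (size s)%:R^-1 * \sum_(a <- s) f a.
Proof.
by rewrite /expect /duniform big_map mulr_sumr; apply: eq_bigr => a _; rewrite div1r.
Qed.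

Lemma expectD A (d : dist R A) f g :
  expect d (fun a => f a + g a) = expect d f + expect d g.
Proof. by rewrite /expect -big_split; apply: eq_bigr => pw _; rewrite mulrDr. Qed.

Lemma expectZ A (d : dist R A) c f : expect d (fun a => c * f a) = c * expect d f.
Proof. by rewrite /expect mulr_sumr; apply: eq_bigr => pw _; rewrite mulrCA. Qed.

Lemma expectN A (d : dist R A) f : expect d (fun a => - f a) = - expect d f.
Proof. by rewrite /expect -sumrN; apply: eq_bigr => pw _; rewrite mulrN. Qed.

Lemma expect_sum A I (s : seq I) (d : dist R A) (F : I -> A -> R) :
  expect d (fun a => \sum_(i <- s) F i a) = \sum_(i <- s) expect d (F i).
Proof. by rewrite /expect exchange_big; apply: eq_bigr => pw _; rewrite mulr_sumr. Qed.

Lemma expect_exchange A B (d : dist R A) (e : dist R B) (f : A -> B -> R) :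
  expect d (fun a => expect e (f a)) = expect e (fun b => expect d (f^~ b)).
Proof.
transitivity (expect d (fun a => \sum_(pw <- e) pw.1 * f a pw.2)) => //.
by rewrite expect_sum; apply: eq_bigr => pw _; rewrite expectZ.
Qed.

Lemma prob_expect A (d : dist R A) P : prob d P = expect d (fun a => (P a)%:R).
Proof. by apply: eq_bigr => pw _; case: (P pw.2); rewrite ?mulr1 ?mulr0. Qed.

Lemma expect_cst A (d : dist R A) c : is_distr d -> expect d (fun=> c) = c.
Proof. by case=> _ sum1; rewrite /expect -mulr_suml sum1 mul1r. Qed.

Lemma ler_expect A (d : dist R A) f g :
  is_distr d -> (forall a, f a <= g a) -> expect d f <= expect d g.
Proof.
case=> d_ge0 _ fg; rewrite /expect; elim: d d_ge0 => [|pw d IH] /=.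
  by rewrite !big_nil.
by case/andP=> pw_ge0 d_ge0; rewrite !big_cons lerD ?IH ?ler_wpM2l.
Qed.

Lemma expect_ge A (d : dist R A) f c :
  is_distr d -> (forall a, c <= f a) -> c <= expect d f.
Proof. by move=> dP cf; rewrite -[leLHS](expect_cst c dP); apply: ler_expect. Qed.

Lemma expect_le A (d : dist R A) f c :
  is_distr d -> (forall a, f a <= c) -> expect d f <= c.
Proof. by move=> dP fc; rewrite -[leRHS](expect_cst c dP); apply: ler_expect. Qed.

Lemma ler_prob A (d : dist R A) (P Q : A -> bool) :
  is_distr d -> (forall a, P a -> Q a) -> prob d P <= prob d Q.
Proof.
move=> dP PQ; rewrite !prob_expect; apply: ler_expect => // a.
by rewrite ler_nat; case: (P a) (PQ a) => // ->.
Qed.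

Lemma prob_negb A (d : dist R A) (P : A -> bool) :
  is_distr d -> prob d (fun a => ~~ P a) = 1 - prob d P.
Proof.
move=> dP; rewrite !prob_expect -[X in X - _](expect_cst _ dP) -expectN -expectD.
by apply: eq_expect => a; case: (P a); rewrite ?subrr ?subr0.
Qed.

Lemma norm_sub_expect_le A (d : dist R A) f c e :
  is_distr d -> (forall a, `|e - f a| <= c) -> `|e - expect d f| <= c.
Proof.
move=> dP fc; have fP a : - c <= e - f a <= c by rewrite -ler_norml.
rewrite ler_norml -[e](expect_cst _ dP) -expectN -expectD.
by rewrite expect_ge ?expect_le// => a; case/andP: (fP a).
Qed.

Lemma is_distr_ret A (a : A) : is_distr (dret R a).
Proof. by split; rewrite /dret /= ?ler01 ?big_seq1. Qed.

Lemma is_distr_bind A B (d : dist R A) (k : A -> dist R B) :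
  is_distr d -> (forall a, is_distr (k a)) -> is_distr (dbind d k).
Proof.
move=> dP kP; split.
  rewrite /dbind; have [d_ge0 _] := dP.
  elim: d d_ge0 {dP} => //= pw d IH /andP[pw_ge0 d_ge0].
  rewrite all_cat IH// andbT all_map.
  by apply: sub_all (kP pw.2).1 => qy qy_ge0 /=; rewrite mulr_ge0.
have : expect (dbind d k) (fun=> 1) = 1.
  by rewrite expect_bind; under eq_expect do rewrite expect_cst//; rewrite expect_cst.
by rewrite /expect; under eq_bigr do rewrite mulr1.
Qed.

Lemma is_distr_uniform A (s : seq A) : (0 < size s)%N -> is_distr (duniform R s).
Proof.
move=> s_gt0; split.
  by rewrite /duniform all_map; apply: sub_all (all_predT s) => a _ /=; rewrite divr_ge0.
rewrite /duniform big_map big_const_seq count_predT iter_addr addr0 /= div1r.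
by rewrite -[LHS]mulr_natr mulVf// pnatr_eq0 -lt0n.
Qed.

End Expectation.

Section ProductDistributions.
Variable R : realType.
Implicit Types A B I : Type.

Lemma expect_dseq0 A f : expect (dseq [::] : dist R (seq A)) f = f [::].
Proof. exact: expect_ret. Qed.

Lemma expect_dseq_cons A (d : dist R A) l f :
  expect (dseq (d :: l)) f = expect d (fun a => expect (dseq l) (fun r => f (a :: r))).
Proof.
rewrite /= expect_bind; apply: eq_expect => a; rewrite expect_bind.
by apply: eq_expect => r; apply: expect_ret.
Qed.

Lemma expect_dseq_cat A (l1 l2 : seq (dist R A)) f :
  expect (dseq (l1 ++ l2)) f =
  expect (dseq l1) (fun r1 => expect (dseq l2) (fun r2 => f (r1 ++ r2))).
Proof.
elim: l1 f => [|d l1 IH] f; first by rewrite expect_dseq0.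
by rewrite cat_cons !expect_dseq_cons; apply: eq_expect => a; rewrite IH.
Qed.

Lemma is_distr_dseq A I (s : seq I) (k : I -> dist R A) :
  (forall i, is_distr (k i)) -> is_distr (dseq (map k s)).
Proof.
move=> kP; elim: s => [|i s IH] /=; first exact: is_distr_ret.
by apply: is_distr_bind => // a; apply: is_distr_bind => // r; apply: is_distr_ret.
Qed.

Lemma eq_expect_dseq A (l : seq (dist R A)) f g :
  (forall r, size r = size l -> f r = g r) -> expect (dseq l) f = expect (dseq l) g.
Proof.
elim: l f g => [|d l IH] f g fg; first by rewrite !expect_dseq0 fg.
rewrite !expect_dseq_cons; apply: eq_expect => a; apply: IH => r r_size.
by apply: fg; rewrite /= r_size.
Qed.

Lemma ler_expect_dseq A I (s : seq I) (k : I -> dist R A) f g :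
  (forall i, is_distr (k i)) ->
  (forall r, size r = size s -> f r <= g r) ->
  expect (dseq (map k s)) f <= expect (dseq (map k s)) g.
Proof.
move=> kP; elim: s f g => [|i s IH] f g fg; first by rewrite !expect_dseq0 fg.
rewrite !expect_dseq_cons; apply: ler_expect => // a; apply: IH => r r_size.
by apply: fg; rewrite /= r_size.
Qed.

Lemma eq_dseq_expect A I (s : seq I) (k k' : I -> dist R A) f :
  (forall i h, expect (k i) h = expect (k' i) h) ->
  expect (dseq (map k s)) f = expect (dseq (map k' s)) f.
Proof.
move=> kk'; elim: s f => [|i s IH] f; first by rewrite !expect_dseq0.
by rewrite !expect_dseq_cons kk'; apply: eq_expect => a; rewrite IH.
Qed.

Lemma expect_dseq_ret A I (s : seq I) (g : I -> A) f :
  expect (dseq [seq dret R (g i) | i <- s]) f = f (map g s).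
Proof.
by elim: s f => [|i s IH] f; rewrite ?expect_dseq0// expect_dseq_cons expect_ret IH.
Qed.

Lemma expect_dseq_zip A B I (s : seq I) (d : I -> dist R A) (k : A -> dist R B) f :
  expect (dseq [seq dbind (d i) (fun a => dbind (k a) (fun b => dret R (a, b))) | i <- s]) f =
  expect (dseq (map d s)) (fun x => expect (dseq (map k x)) (fun y => f (zip x y))).
Proof.
elim: s f => [|i s IH] f; first by rewrite !expect_dseq0.
rewrite !expect_dseq_cons expect_bind; apply: eq_expect => a.
rewrite expect_bind; under eq_expect do rewrite expect_ret IH.
by rewrite expect_exchange; apply: eq_expect => x; rewrite expect_dseq_cons.
Qed.

Lemma expect_dseq_sum A I (s : seq I) (k : I -> dist R A) (f : A -> R) :
  (forall i, is_distr (k i)) ->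
  expect (dseq (map k s)) (fun r => \sum_(a <- r) f a) = \sum_(i <- s) expect (k i) f.
Proof.
move=> kP; elim: s => [|i s IH]; first by rewrite expect_dseq0 !big_nil.
have sP : is_distr (dseq (map k s)) by apply: is_distr_dseq.
rewrite expect_dseq_cons big_cons -IH.
rewrite -[X in _ + X](expect_cst _ (kP i)) -expectD; apply: eq_expect => a.
by under eq_expect do rewrite big_cons; rewrite expectD expect_cst.
Qed.

End ProductDistributions.

Section CentralMoments.
Variable R : realType.
Implicit Types A B I : Type.

Definition central_moment A (m : nat) (d : dist R A) (f : A -> R) : R :=
  expect d (fun a => (f a - expect d f) ^+ m).

Definition variance A : dist R A -> (A -> R) -> R := @central_moment A 2.

Lemma eq_central_moment A m (d : dist R A) f g :
  f =1 g -> central_moment m d f = central_moment m d g.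
Proof.
by move=> fg; rewrite /central_moment (eq_expect d fg); apply: eq_expect => a; rewrite fg.
Qed.

Lemma central_moment_ge0 A m (d : dist R A) f :
  ~~ odd m -> is_distr d -> 0 <= central_moment m d f.
Proof. by move=> m_even dP; apply: expect_ge => // a; apply: exprn_even_ge0. Qed.

Lemma expect_centered A (d : dist R A) f :
  is_distr d -> expect d (fun a => f a - expect d f) = 0.
Proof. by move=> dP; rewrite expectD expect_cst// subrr. Qed.

Lemma expect_sqr_sub A (d : dist R A) f c :
  is_distr d -> expect d (fun a => (f a - c) ^+ 2) = (expect d f - c) ^+ 2 + variance d f.
Proof.
move=> dP; set m := expect d f.
transitivity (expect d (fun a => (m - c) ^+ 2 + (2 * (m - c) * (f a - m) + (f a - m) ^+ 2))).
  by apply: eq_expect => a; ring.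
by rewrite expectD expect_cst// expectD expectZ expect_centered// mulr0 add0r.
Qed.

Lemma varianceE A (d : dist R A) f :
  is_distr d -> variance d f = expect d (fun a => f a ^+ 2) - expect d f ^+ 2.
Proof.
move=> dP; apply/eqP; rewrite eq_sym subr_eq addrC -[expect d f in X in X + _]subr0.
by rewrite -expect_sqr_sub//; apply/eqP/eq_expect => a; rewrite subr0.
Qed.

Lemma variance_translate A (d : dist R A) f c :
  is_distr d -> variance d (fun a => f a + c) = variance d f.
Proof.
move=> dP; rewrite /variance /central_moment expectD expect_cst//.
by apply: eq_expect => a; congr (_ ^+ 2); ring.
Qed.

Lemma variance_le_sqr A (d : dist R A) f c :
  is_distr d -> (forall a, `|f a - expect d f| <= c) -> variance d f <= c ^+ 2.
Proof.
move=> dP fc; apply: expect_le => // a.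
by rewrite -[leLHS]real_normK ?num_real// lerXn2r ?nnegrE ?(le_trans _ (fc a)).
Qed.

Lemma variance_bind A B (d : dist R A) (k : A -> dist R B) f :
  (forall a, is_distr (k a)) ->
  variance (dbind d k) f =
  variance d (fun a => expect (k a) f) + expect d (fun a => variance (k a) f).
Proof.
move=> kP; rewrite /variance [LHS]/central_moment [in RHS]/(central_moment 2 d _).
rewrite !expect_bind -expectD.
by apply: eq_expect => a; rewrite expect_sqr_sub.
Qed.

(* (x + y)^4 <= 8 (x^4 + y^4) *)
Lemma fourth_moment_bind_le A B (d : dist R A) (k : A -> dist R B) f :
  is_distr d -> (forall a, is_distr (k a)) ->
  central_moment 4 (dbind d k) f <=
  8 * (central_moment 4 d (fun a => expect (k a) f) +
       expect d (fun a => central_moment 4 (k a) f)).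
Proof.
move=> dP kP; rewrite {1 2}/central_moment !expect_bind -expectD -expectZ.
apply: ler_expect => // a; set m := expect d _; set g := expect (k a) f.
rewrite -[(g - m) ^+ 4](expect_cst _ (kP a)) -expectD -expectZ.
apply: ler_expect => // b.
have -> : f b - m = (g - m) + (f b - g) by ring.
set x := g - m; set y := f b - g.
have -> : 8 * (x ^+ 4 + y ^+ 4) =
    (x + y) ^+ 4 + (x - y) ^+ 2 * ((x - y) ^+ 2 + 6 * (x + y) ^+ 2) by ring.
by rewrite lerDl mulr_ge0 ?sqr_ge0// addr_ge0 ?sqr_ge0// mulr_ge0 ?sqr_ge0.
Qed.

Lemma chebyshev A m (d : dist R A) f (t : R) :
  ~~ odd m -> is_distr d -> 0 < t ->
  prob d (fun a => t <= `|f a - expect d f|) <= central_moment m d f / t ^+ m.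
Proof.
move=> m_even dP t_gt0; rewrite prob_expect ler_pdivlMr ?exprn_gt0// mulrC -expectZ.
apply: ler_expect => // a; case: (lerP t) => [tf|_] /=; last by rewrite mulr0 exprn_even_ge0.
rewrite mulr1 -[leRHS]ger0_norm ?exprn_even_ge0// normrX.
by rewrite lerXn2r ?nnegrE ?(ltW t_gt0).
Qed.

Lemma expect_dseq_consr A (d : dist R A) l f :
  expect (dseq (d :: l)) f = expect (dseq l) (fun r => expect d (fun a => f (a :: r))).
Proof. by rewrite expect_dseq_cons expect_exchange. Qed.

Lemma variance_dseq_cons A (d : dist R A) l f :
  is_distr d ->
  variance (dseq (d :: l)) f =
  variance (dseq l) (fun r => expect d (fun a => f (a :: r))) +
  expect (dseq l) (fun r => variance d (fun a => f (a :: r))).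
Proof.
move=> dP; rewrite /variance {1 2}/central_moment !expect_dseq_consr -expectD.
by apply: eq_expect => r; rewrite expect_sqr_sub.
Qed.

Lemma variance_dseq_sum A I (s : seq I) (k : I -> dist R A) (f : A -> R) :
  (forall i, is_distr (k i)) ->
  variance (dseq (map k s)) (fun r => \sum_(a <- r) f a) = \sum_(i <- s) variance (k i) f.
Proof.
move=> kP; elim: s => [|i s IH].
  by rewrite /variance /central_moment !expect_dseq0 !big_nil subr0 expr0n.
have sP : is_distr (dseq (map k s)) by apply: is_distr_dseq.
rewrite variance_dseq_cons// big_cons -IH addrC; congr (_ + _).
  rewrite -[RHS](expect_cst _ sP); apply: eq_expect => r.
  rewrite -(variance_translate f (\sum_(b <- r) f b) (kP i)).
  by apply: eq_central_moment => a; rewrite big_cons.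
rewrite -[RHS](variance_translate _ (expect (k i) f) sP); apply: eq_central_moment => r.
by under eq_expect do rewrite big_cons; rewrite expectD expect_cst// addrC.
Qed.

End CentralMoments.

Section BoundedDifferences.
Variables (R : realType) (A : Type).

Definition bounded_difference (c : R) (f : seq A -> R) : Prop :=
  forall r1 a a' r2, `|f (r1 ++ a :: r2) - f (r1 ++ a' :: r2)| <= c.

Lemma bounded_difference_expect c (d : dist R A) f :
  is_distr d -> bounded_difference c f ->
  bounded_difference c (fun r => expect d (fun a => f (a :: r))).
Proof.
move=> dP fc r1 a a' r2; rewrite -expectN -expectD -[X in `|X|]subr0 -normrN opprB.
apply: norm_sub_expect_le => // b; rewrite sub0r normrN; exact: (fc (b :: r1)).
Qed.

Lemma bounded_difference_head c (d : dist R A) f r a :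
  is_distr d -> bounded_difference c f ->
  `|f (a :: r) - expect d (fun b => f (b :: r))| <= c.
Proof.
by move=> dP fc; apply: norm_sub_expect_le => // b; apply: (fc [::]).
Qed.

Lemma bounded_difference_variance_le c I (s : seq I) (k : I -> dist R A) f :
  (forall i, is_distr (k i)) -> bounded_difference c f ->
  variance (dseq (map k s)) f <= (size s)%:R * c ^+ 2.
Proof.
move=> kP; elim: s f => [|i s IH] f fc.
  by rewrite /variance /central_moment !expect_dseq0 subrr expr0n mul0r.
rewrite variance_dseq_cons// -natr1 mulrDl mul1r; apply: lerD.
  exact/IH/bounded_difference_expect.
apply: expect_le => [|r]; first exact: is_distr_dseq.
by apply: variance_le_sqr => // a; apply: bounded_difference_head.
Qed.

(* The odd moment 4 G^3 D vanishes in expectation and 4 G D^3 <= 2 G^2 D^2 + 2 D^4. *)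
Lemma expect_fourth_sub_le B (c t : R) (d : dist R B) f :
  is_distr d -> (forall a, `|f a - expect d f| <= c) ->
  expect d (fun a => (f a - t) ^+ 4) <=
  (expect d f - t) ^+ 4 + 8 * c ^+ 2 * (expect d f - t) ^+ 2 + 3 * c ^+ 4.
Proof.
move=> dP; set m := expect d f => fc; set G := m - t; set bnd := (X in _ <= X).
apply: (le_trans (y := expect d (fun a => bnd + 4 * G ^+ 3 * (f a - m)))); last first.
  by rewrite expectD expectZ expect_centered// mulr0 addr0 expect_cst.
apply: ler_expect => // a; set D := f a - m.
have -> : f a - t = G + D by rewrite /G /D; ring.
have D2 : D ^+ 2 <= c ^+ 2.
  by rewrite -[leLHS]real_normK ?num_real// lerXn2r ?nnegrE ?(le_trans _ (fc a)).
have D4 : D ^+ 4 <= c ^+ 4.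
  by rewrite (exprM D 2 2) (exprM c 2 2) lerXn2r ?nnegrE ?sqr_ge0.
have GD : G ^+ 2 * D ^+ 2 <= G ^+ 2 * c ^+ 2 by rewrite ler_wpM2l ?sqr_ge0.
have -> : (G + D) ^+ 4 = G ^+ 4 + 4 * G ^+ 3 * D + 8 * (G ^+ 2 * D ^+ 2) + 3 * D ^+ 4
    - 2 * (G * D - D ^+ 2) ^+ 2 by ring.
have := sqr_ge0 (G * D - D ^+ 2); rewrite /bnd; lra.
Qed.

Lemma bounded_difference_fourth_moment_le c I (s : seq I) (k : I -> dist R A) f :
  (forall i, is_distr (k i)) -> bounded_difference c f ->
  central_moment 4 (dseq (map k s)) f <= 4 * (size s)%:R ^+ 2 * c ^+ 4.
Proof.
move=> kP; elim: s f => [|i s IH] f fc.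
  by rewrite /central_moment !expect_dseq0 subrr !expr0n /= mulr0 mul0r.
set g := fun r => expect (k i) (fun a => f (a :: r)).
have gc : bounded_difference c g by apply: bounded_difference_expect.
have sP : is_distr (dseq (map k s)) by apply: is_distr_dseq.
apply: (le_trans (y := central_moment 4 (dseq (map k s)) g
    + 8 * c ^+ 2 * variance (dseq (map k s)) g + 3 * c ^+ 4)).
  rewrite -[3 * _](expect_cst _ sP) -expectZ -!expectD /central_moment !expect_dseq_consr.
  apply: ler_expect => // r; apply: expect_fourth_sub_le => // a.
  exact: bounded_difference_head.
have var_le := bounded_difference_variance_le s kP gc.
have c2_ge0 : 0 <= 8 * c ^+ 2 by rewrite mulr_ge0 ?sqr_ge0.
have c4_ge0 : 0 <= c ^+ 4 by rewrite exprn_even_ge0.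
have := lerD (IH g gc) (ler_wpM2l c2_ge0 var_le).
rewrite -[(size (i :: s))%:R]natr1.
have -> : 4 * ((size s)%:R + 1) ^+ 2 * c ^+ 4 = 4 * (size s)%:R ^+ 2 * c ^+ 4 +
   8 * c ^+ 2 * ((size s)%:R * c ^+ 2) + 4 * c ^+ 4 by ring.
lra.
Qed.

End BoundedDifferences.

Section Binomial.
Variables (R : realType) (p : R).
Implicit Types (A B r : nat) (F : nat -> R).

Definition bernoulli : dist R bool := [:: (p, true); (1 - p, false)].

Fixpoint binom_distr A : dist R nat :=
  if A is A'.+1
  then dbind bernoulli (fun b : bool => dbind (binom_distr A') (fun i => dret R (b + i)%N))
  else dret R 0%N.

Lemma expect_bernoulli (f : bool -> R) :
  expect bernoulli f = p * f true + (1 - p) * f false.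
Proof. by rewrite /expect big_cons big_seq1. Qed.

Lemma expect_binom0 F : expect (binom_distr 0) F = F 0%N.
Proof. exact: expect_ret. Qed.

Lemma expect_binomS A F :
  expect (binom_distr A.+1) F =
  p * expect (binom_distr A) (fun i => F i.+1) + (1 - p) * expect (binom_distr A) F.
Proof.
rewrite /= expect_bind expect_bernoulli !expect_bind.
by congr (_ * _ + _ * _); apply: eq_expect => i; rewrite expect_ret.
Qed.

Lemma expect_binomD A B F :
  expect (binom_distr A) (fun i => expect (binom_distr B) (fun j => F (i + j)%N)) =
  expect (binom_distr (A + B)) F.
Proof.
elim: A F => [|A IH] F; first by rewrite expect_binom0.
by rewrite addSn !expect_binomS -(IH (fun i => F i.+1)) -IH.
Qed.

Lemma expect_binom_bin r A F :
  expect (binom_distr A) (fun i => 'C(i, r)%:R * F i) =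
  'C(A, r)%:R * p ^+ r * expect (binom_distr (A - r)) (fun i => F (i + r)%N).
Proof.
elim: A r F => [|A IH] [|r] F.
- by rewrite !expect_binom0 bin0 expr0 mulr1 addn0.
- by rewrite !expect_binom0 bin0n !mul0r.
- rewrite bin0 expr0 !mul1r subn0; apply: eq_expect => i.
  by rewrite bin0 mul1r addn0.
rewrite expect_binomS IH subSS.
have -> : expect (binom_distr A) (fun i => 'C(i.+1, r.+1)%:R * F i.+1) =
    'C(A, r.+1)%:R * p ^+ r.+1 * expect (binom_distr (A - r.+1)) (fun i => F (i + r.+1).+1) +
    'C(A, r)%:R * p ^+ r * expect (binom_distr (A - r)) (fun i => F (i + r.+1)%N).
  under [X in _ + _ * X]eq_expect do rewrite addnS.
  rewrite -(IH _ (fun i => F i.+1)) -(IH r (fun i => F i.+1)) -expectD.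
  by apply: eq_expect => i; rewrite binS natrD mulrDl.
rewrite binS natrD exprS; have [Ar|rA] := leqP A r.
  by rewrite (bin_small (Ar : A < r.+1)%N); ring.
by rewrite -(subnSK rA) expect_binomS; ring.
Qed.

Lemma prob_binom_eq A r :
  prob (binom_distr A) (pred1 r) = 'C(A, r)%:R * p ^+ r * (1 - p) ^+ (A - r).
Proof.
have zero B : prob (binom_distr B) (pred1 0%N) = (1 - p) ^+ B.
  rewrite prob_expect; elim: B => [|B IH]; first by rewrite expect_binom0.
  by rewrite expect_binomS IH -(expectZ _ p) exprS -[RHS]add0r; congr (_ + _);
     rewrite /expect big1// => i _ /=; rewrite !mulr0.
rewrite -zero !prob_expect.
transitivity (expect (binom_distr A) (fun i => 'C(i, r)%:R * (i == r)%:R)).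
  by apply: eq_expect => i /=; case: eqP => [->|_]; rewrite ?binn ?mul1r ?mulr0.
rewrite (expect_binom_bin _ _ (fun i => (i == r)%:R)); congr (_ * _).
by apply: eq_expect => i /=; rewrite -{2}[r]add0n eqn_add2r.
Qed.

Hypothesis p01 : 0 <= p <= 1.

Lemma is_distr_bernoulli : is_distr bernoulli.
Proof.
case/andP: p01 => p_ge0 p_le1; split; first by rewrite /= p_ge0 subr_ge0 p_le1.
by rewrite big_cons big_seq1 addrC subrK.
Qed.

Lemma is_distr_binom A : is_distr (binom_distr A).
Proof.
elim: A => [|A IH]; first exact: is_distr_ret.
apply: is_distr_bind => [|b]; first exact: is_distr_bernoulli.
by apply: is_distr_bind => // i; apply: is_distr_ret.
Qed.

Lemma prob_binom_ge A r :
  prob (binom_distr A) (fun i => r <= i)%N = 1 - prob (binom_distr A) (fun i => i < r)%N.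
Proof.
rewrite -(prob_negb _ (is_distr_binom A)) !prob_expect.
by apply: eq_expect => i; rewrite -leqNgt.
Qed.

Lemma prob_binom_lt_anti A B r :
  (A <= B)%N ->
  prob (binom_distr B) (fun i => i < r)%N <= prob (binom_distr A) (fun i => i < r)%N.
Proof.
move=> /subnKC <-; rewrite !prob_expect -expect_binomD.
apply: ler_expect => [|i]; first exact: is_distr_binom.
apply: expect_le => [|j]; first exact: is_distr_binom.
rewrite ler_nat; case: (ltnP (i + j) r) => // ij_lt_r.
by rewrite (leq_ltn_trans (leq_addr _ _) ij_lt_r).
Qed.

Lemma prob_binom_lt A r :
  prob (binom_distr A) (fun i => i < r)%N =
  \sum_(j < r) 'C(A, j)%:R * p ^+ j * (1 - p) ^+ (A - j).
Proof.
under eq_bigr do rewrite -prob_binom_eq prob_expect.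
rewrite -expect_sum prob_expect; apply: eq_expect => i.
have [ir|ri] := ltnP i r; last first.
  by rewrite big1// => j _ /=; rewrite gtn_eqF// (leq_trans (ltn_ord j)).
rewrite (bigD1 (Ordinal ir)) //= eqxx big1 ?addr0//= => j.
by rewrite -val_eqE eq_sym /= => /negbTE ->.
Qed.

End Binomial.

Lemma ffact_le_expn (m r : nat) : (m ^_ r <= m ^ r)%N.
Proof. by elim: r => [|r IH] //; rewrite ffactnSr expnSr leq_mul// leq_subr. Qed.

Section PoissonDomination.
Variable R : realType.

Lemma binom_term_le_poisson (p : R) (A j : nat) : 0 <= p < 1 ->
  'C(A, j)%:R * p ^+ j * (1 - p) ^+ (A - j) <=
  expR (- (A%:R * p)) * ((A%:R * p / (1 - p)) ^+ j / j`!%:R).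
Proof.
move=> /andP[p_ge0 p_lt1]; have q_gt0 : 0 < 1 - p by rewrite subr_gt0.
have j_fact : 0 < j`!%:R :> R by rewrite ltr0n fact_gt0.
have [Aj|jA] := ltnP A j.
  rewrite bin_small// !mul0r mulr_ge0 ?expR_ge0// divr_ge0// ?exprn_ge0 ?divr_ge0 ?mulr_ge0//.
  exact: ltW.
have pow_le : (1 - p) ^+ A <= expR (- (A%:R * p)).
  rewrite -mulrN expRM_natl lerXn2r ?nnegrE ?expR_ge0 ?(ltW q_gt0)//.
  exact: expR_ge1Dx.
have -> : (1 - p) ^+ (A - j) = (1 - p) ^+ A / (1 - p) ^+ j.
  by rewrite -[in RHS](subnK jA) exprD mulfK// expf_neq0// gt_eqF.
have -> : expR (- (A%:R * p)) * ((A%:R * p / (1 - p)) ^+ j / j`!%:R) =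
    A%:R ^+ j / j`!%:R * p ^+ j * (expR (- (A%:R * p)) / (1 - p) ^+ j).
  by rewrite !exprMn exprVn; ring.
apply: ler_pM; rewrite ?mulr_ge0 ?invr_ge0 ?exprn_ge0 ?(ltW q_gt0)//.
  rewrite ler_wpM2r ?exprn_ge0// ler_pdivlMr// -natrM bin_ffact -natrX ler_nat.
  exact: ffact_le_expn.
by rewrite ler_pM2r// invr_gt0 exprn_gt0.
Qed.

Lemma prob_binom_lt_le_poisson (p : R) (A r : nat) : 0 <= p < 1 ->
  prob (binom_distr p A) (fun i => i < r)%N <=
  expR (- (A%:R * p)) * \sum_(j < r) (A%:R * p / (1 - p)) ^+ j / j`!%:R.
Proof.
move=> p01; rewrite prob_binom_lt mulr_sumr.
by apply: ler_sum => j _; apply: binom_term_le_poisson.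
Qed.

End PoissonDomination.

Lemma card_draws_meet (T : finType) (U : {set T}) (k r : nat) : (r <= k)%N ->
  #|[set S : {set T} | (#|S| == k) && (#|S :&: U| == r)]| =
  ('C(#|U|, r) * 'C(#|~: U|, k - r))%N.
Proof.
move=> rk; rewrite -(cards_draws U r) -(cards_draws (~: U) (k - r)%N) -cardsX.
set X := [set S : {set T} | S \subset U & _].
set Y := [set S : {set T} | S \subset ~: U & _].
pose union (q : {set T} * {set T}) := q.1 :|: q.2.
pose split (S : {set T}) := (S :&: U, S :\: U).
have splitK q : q \in setX X Y -> split (union q) = q.
  case: q => S1 S2; rewrite !inE /= => /andP[/andP[S1U _] /andP[S2U _]].
  have S2U0 : S2 :&: U = set0 by apply/eqP; rewrite setI_eq0 -[U]setCK -subsets_disjoint.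
  have S1U0 : S1 :\: U = set0 by apply/eqP; rewrite setD_eq0.
  rewrite /split setIUl setDUl (setIidPl S1U) S2U0 setU0 S1U0 set0U.
  by rewrite setDE (setIidPl S2U).
rewrite -(card_in_imset (f := union)); last exact: can_in_inj splitK.
apply: eq_card => S; apply/idP/imsetP => [|[q qXY ->]].
  rewrite inE => /andP[/eqP Sk /eqP Sr]; exists (split S); last by rewrite /union setID.
  by rewrite !inE /= subsetIr Sr eqxx setDE subsetIr /= -setDE cardsD Sk Sr.
have [qU qD] : union q :&: U = q.1 /\ union q :\: U = q.2.
  by have := splitK q qXY; rewrite /split; case: q {qXY} => ? ? [-> ->].
move: qXY; rewrite !inE => /andP[/andP[_ /eqP q1] /andP[_ /eqP q2]].
by rewrite -(cardsID U) qU qD q1 q2 subnKC// !eqxx.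
Qed.

Section Draws.
Variable R : realType.
Implicit Types (i j l r : nat) (g : nat -> R).

(* Mean of [g r], for [r] the number of ones among [l] balls drawn without
   replacement from [i] ones and [j] zeros (0 if there are fewer than [l] balls). *)
Definition draw_mean l i j g : R :=
  (\sum_(r < l.+1) 'C(i, r)%:R * 'C(j, l - r)%:R * g r) / 'C(i + j, l)%:R.

Lemma draw_mean_small l i j g : (i + j < l)%N -> draw_mean l i j g = 0.
Proof. by move=> ijl; rewrite /draw_mean bin_small// invr0 mulr0. Qed.

Lemma draw_mean_antisym l i j g : (forall r, (r <= l)%N -> g (l - r)%N = - g r) ->
  draw_mean l i j g = - draw_mean l j i g.
Proof.
move=> g_odd; rewrite /draw_mean addnC -mulNr; congr (_ / _).
rewrite (reindex_inj rev_ord_inj) -sumrN /=; apply: eq_bigr => r _.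
have rl : (r <= l)%N by rewrite -ltnS.
by rewrite subSS subKn// g_odd//; ring.
Qed.

Lemma expect_uniform_draws (T : finType) (U : {set T}) l g :
  expect (duniform R (enum [set S : {set T} | #|S| == l])) (fun S => g #|S :&: U|) =
  draw_mean l #|U| #|~: U| g.
Proof.
rewrite expect_uniform -cardE card_draws /draw_mean cardsC mulrC; congr (_ / _).
transitivity (\sum_(S in [set S : {set T} | #|S| == l])
    \sum_(r < l.+1) (#|S :&: U| == r)%:R * g r).
  rewrite big_enum; apply: eq_bigr => S; rewrite inE => /eqP Sl.
  have SUl : (#|S :&: U| < l.+1)%N by rewrite ltnS -Sl subset_leq_card// subsetIl.
  rewrite (bigD1 (Ordinal SUl)) //= eqxx mul1r big1 ?addr0// => r.
  by rewrite -val_eqE eq_sym /= => /negbTE ->; rewrite mul0r.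
rewrite exchange_big; apply: eq_bigr => r _; rewrite -mulr_suml -natrM; congr (_ * _).
have rl : (r <= l)%N by rewrite -ltnS.
rewrite -(card_draws_meet U rl) -sum1dep_card natr_sum [RHS]big_mkcondr /=.
by apply: eq_big => [S|S _]; rewrite ?inE//; case: eqP.
Qed.

Lemma expect_binom_bin2 (p : R) A B a b (F : nat -> R) :
  expect (binom_distr p A) (fun i => expect (binom_distr p B) (fun j =>
    'C(i, a)%:R * 'C(j, b)%:R * F (i + j)%N)) =
  'C(A, a)%:R * 'C(B, b)%:R *
    (p ^+ (a + b) * expect (binom_distr p (A + B - (a + b))) (fun m => F (m + (a + b))%N)).
Proof.
transitivity (expect (binom_distr p A) (fun i => 'C(i, a)%:R * ('C(B, b)%:R * p ^+ b *
    expect (binom_distr p (B - b)) (fun j => F (i + (j + b))%N)))).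
  apply: eq_expect => i; rewrite -(expect_binom_bin _ _ _ (fun j => F (i + j)%N)) -expectZ.
  by apply: eq_expect => j; rewrite mulrA.
rewrite (expect_binom_bin _ _ _ (fun i => 'C(B, b)%:R * p ^+ b *
  expect (binom_distr p (B - b)) (fun j => F (i + (j + b))%N))) expectZ.
have [Aa|aA] := ltnP A a; first by rewrite (bin_small Aa) !mul0r.
have [Bb|bB] := ltnP B b; first by rewrite (bin_small Bb) !(mul0r, mulr0).
have -> : (A + B - (a + b) = (A - a) + (B - b))%N by lia.
under eq_expect => i do under eq_expect => j do rewrite addnACA.
rewrite (expect_binomD _ _ _ (fun m => F (m + (a + b))%N)) exprD; ring.
Qed.

(* Exchangeability: [l] balls drawn from the content of a random bin are
   distributed like [l] balls drawn from all of them. *)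
Lemma expect_binom_draw_mean (p : R) l A B g :
  expect (binom_distr p A) (fun i => expect (binom_distr p B) (fun j => draw_mean l i j g)) =
  draw_mean l A B g * prob (binom_distr p (A + B)) (fun m => l <= m)%N.
Proof.
pose F m : R := 'C(m, l)%:R^-1.
pose M := p ^+ l * expect (binom_distr p (A + B - l)) (fun m => F (m + l)%N).
have -> : prob (binom_distr p (A + B)) (fun m => l <= m)%N = 'C(A + B, l)%:R * M.
  rewrite prob_expect /M mulrA -expect_binom_bin; apply: eq_expect => m; rewrite /F.
  have [lm|ml] := leqP l m; last by rewrite bin_small// mul0r.
  by rewrite divff// pnatr_eq0 -lt0n bin_gt0.
transitivity (\sum_(r < l.+1) g r * ('C(A, r)%:R * 'C(B, l - r)%:R * M)).
  transitivity (\sum_(r < l.+1) expect (binom_distr p A) (fun i =>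
      expect (binom_distr p B) (fun j => g r * ('C(i, r)%:R * 'C(j, l - r)%:R * F (i + j)%N)))).
    rewrite -expect_sum; apply: eq_expect => i; rewrite -expect_sum; apply: eq_expect => j.
    by rewrite /draw_mean mulr_suml; apply: eq_bigr => r _; rewrite /F; ring.
  apply: eq_bigr => r _; under eq_expect do rewrite expectZ.
  by rewrite expectZ expect_binom_bin2 subnKC// -ltnS.
have [ABl|lAB] := ltnP (A + B) l.
  rewrite draw_mean_small// mul0r big1// => r _.
  have [Ar|rA] := ltnP A r; first by rewrite (bin_small Ar) !(mul0r, mulr0).
  by rewrite (bin_small (_ : B < l - r)%N) ?(mul0r, mulr0)//; lia.
have bin_neq0 : 'C(A + B, l)%:R != 0 :> R by rewrite pnatr_eq0 -lt0n bin_gt0.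
by rewrite /draw_mean mulrA divfK// mulr_suml; apply: eq_bigr => r _; ring.
Qed.

End Draws.

Lemma natr_bin2 (R : numFieldType) (r : nat) : 'C(r, 2)%:R = r%:R * (r%:R - 1) / 2 :> R.
Proof.
elim: r => [|r IH]; first by rewrite !mul0r.
by rewrite binS natrD bin1 IH -natr1; field.
Qed.

Lemma natr_bin3 (R : numFieldType) (r : nat) :
  'C(r, 3)%:R = r%:R * (r%:R - 1) * (r%:R - 2) / 6 :> R.
Proof.
elim: r => [|r IH]; first by rewrite !mul0r.
by rewrite binS natrD IH natr_bin2 -natr1; field.
Qed.

Section NodeUpdate.
Variable R : realType.
Implicit Types (o : option bool) (s : seq bool).

Definition spin o : R := if o is Some b then (if b then 1 else -1) else 0.

Definition defined o : R := (isSome o)%:R.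

Definition majority_spin (l r : nat) : R := spin (Some (l < 2 * r)%N).

Definition value_distr (l : nat) (blocked : bool) s : dist R (option bool) :=
  if blocked || (size s < l)%N then dret R None
  else dbind (duniform R (enum [set S : {set 'I_(size s)} | #|S| == l]))
         (fun S => dret R (Some (majority [seq nth false s (nat_of_ord i) | i in S]))).

Lemma norm_spin_le1 o : `|spin o| <= 1.
Proof. by case: o => [[]|]; rewrite /spin ?normrN ?normr1 ?normr0 ?ler01. Qed.

Lemma spin_sqr o : spin o ^+ 2 = defined o.
Proof. by case: o => [[]|]; rewrite /spin /defined /= ?sqrrN ?expr1n ?expr0n. Qed.

Lemma majority_spin_antisym l r : odd l -> (r <= l)%N ->
  majority_spin l (l - r) = - majority_spin l r.
Proof.
move=> l_odd rl; rewrite /majority_spin /spin.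
have -> : (l < 2 * (l - r))%N = ~~ (l < 2 * r)%N by lia.
by case: (l < 2 * r)%N; rewrite ?opprK.
Qed.

Lemma draw_mean_majority3 (i j : nat) (m := i%:R + j%:R : R) :
  draw_mean 3 i j (majority_spin 3) =
  (i%:R - j%:R) * ((m - 1) * (m - 2) + 2 * i%:R * j%:R) / (m * (m - 1) * (m - 2)).
Proof.
rewrite /draw_mean !big_ord_recr big_ord0 /= !bin0 !bin1 !natr_bin2 !natr_bin3 natrD -/m.
rewrite /majority_spin /spin /= invf_div mulrA; congr (_ / _).
by rewrite /m; field.
Qed.

Lemma count_negb s : count negb s = (size s - count id s)%N.
Proof. by rewrite -(count_predC id s) addKn; apply: eq_count. Qed.

Lemma count_id_negb s : (count id s + count negb s)%N = size s.
Proof. by rewrite count_negb subnKC// count_size. Qed.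

Lemma card_ord_nth s : #|[set i : 'I_(size s) | nth false s i]| = count id s.
Proof.
rewrite -sum1dep_card -sum1_count (big_nth false) big_mkord.
by apply: eq_bigl => i.
Qed.

Lemma count_image_nth (m : nat) s (S : {set 'I_m}) :
  count id [seq nth false s (nat_of_ord i) | i in S] =
  #|S :&: [set i : 'I_m | nth false s i]|.
Proof.
rewrite count_map -sum1_count -[in LHS]big_filter.
rewrite -sum1_card big_filter big_enum_cond /=.
by apply: eq_bigl => i; rewrite !inE.
Qed.

Lemma is_distr_draws (m l : nat) : (l <= m)%N ->
  is_distr (duniform R (enum [set S : {set 'I_m} | #|S| == l])).
Proof.
by move=> lm; apply: is_distr_uniform; rewrite -cardE card_draws card_ord bin_gt0.
Qed.

Lemma is_distr_value_distr l blocked s : is_distr (value_distr l blocked s).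
Proof.
rewrite /value_distr; case: ifP => [_|/norP[_]]; first exact: is_distr_ret.
rewrite -leqNgt => ls.
by apply: is_distr_bind => [|S]; [apply: is_distr_draws|apply: is_distr_ret].
Qed.

Lemma expect_value_distr l s f : (l <= size s)%N ->
  expect (value_distr l false s) f =
  draw_mean l (count id s) (count negb s) (fun r => f (Some (l < 2 * r)%N)).
Proof.
move=> ls; rewrite /value_distr ltnNge ls /= expect_bind.
pose U := [set i : 'I_(size s) | nth false s i].
have cardU : #|U| = count id s by apply: card_ord_nth.
have cardUC : #|~: U| = count negb s by rewrite cardsCs setCK card_ord cardU count_negb.
rewrite -cardU -cardUC -(expect_uniform_draws U l (fun r => f (Some (l < 2 * r)%N))).
rewrite !expect_uniform; congr (_ * _); rewrite !big_enum; apply: eq_bigr => S.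
by rewrite inE expect_ret /majority size_map -cardE count_image_nth => /eqP ->.
Qed.

Lemma expect_value_distr_defined l blocked s :
  expect (value_distr l blocked s) defined = (~~ blocked && (l <= size s)%N)%:R.
Proof.
have [/andP[/negbTE -> ls]|] := boolP (~~ blocked && (l <= size s)%N); last first.
  by rewrite negb_and negbK -ltnNge /value_distr => ->; rewrite expect_ret.
rewrite /value_distr ltnNge ls /= expect_bind.
by under eq_expect do rewrite expect_ret; rewrite expect_cst//; apply: is_distr_draws.
Qed.

Lemma expect_value_distr_spin l blocked s :
  expect (value_distr l blocked s) spin =
  (~~ blocked)%:R * draw_mean l (count id s) (count negb s) (majority_spin l).
Proof.
case: blocked; first by rewrite mul0r expect_ret.
rewrite mul1r; have [ls|sl] := leqP l (size s); first by rewrite expect_value_distr.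
by rewrite /value_distr sl expect_ret draw_mean_small ?count_id_negb.
Qed.

End NodeUpdate.

Section Messages.
Variables (R : realType) (n k l : nat).
Hypothesis n_gt0 : (0 < n)%N.
Implicit Types (x : seq (option bool)) (bs : seq bool) (v : 'I_n) (B : {set 'I_n}).

Definition uniform_node : dist R 'I_n := duniform R (enum 'I_n).

Definition targets_distr bs : dist R (seq 'I_n) := dseq (map (fun=> uniform_node) bs).

Definition inbox (r : seq (bool * 'I_n)) v : seq bool := [seq q.1 | q <- r & q.2 == v].

Definition sent_values x : seq bool :=
  flatten [seq if o is Some b then nseq k b else [::] | o <- x].

Definition addressed_messages (r : seq (option bool * seq 'I_n)) : seq (bool * 'I_n) :=
  flatten [seq if q.1 is Some b then [seq (b, t) | t <- q.2] else [::] | q <- r].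

Definition node_targets_distr (o : option bool) : dist R (seq 'I_n) :=
  if o is Some _
  then dbind (duniform R (enum {: k.-tuple 'I_n})) (fun ts => dret R (val ts))
  else dret R [::].

Definition send_distr x : dist R (config n) :=
  dbind (dseq (map node_targets_distr x)) (fun t => dret R (assemble (zip x t))).

Definition update_distr B (c : config n) : dist R (seq (option bool)) :=
  dseq [seq value_distr R l (u \in B) (c.2 u) | u <- enum 'I_n].

Definition receive_distr B bs (w : seq 'I_n) : dist R (seq (option bool)) :=
  dseq [seq value_distr R l (u \in B) (inbox (zip bs w) u) | u <- enum 'I_n].

(* From the values sent in one round to the values after the next one, whose blocked
   set [B] is fixed before the messages are thrown. *)
Definition value_kernel B x : dist R (seq (option bool)) :=
  dbind (targets_distr (sent_values x)) (receive_distr B (sent_values x)).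

Lemma is_distr_uniform_node : is_distr uniform_node.
Proof. by apply: is_distr_uniform; rewrite -cardE card_ord. Qed.

Lemma is_distr_targets bs : is_distr (targets_distr bs).
Proof. by apply: is_distr_dseq => _; apply: is_distr_uniform_node. Qed.

Lemma is_distr_uniform_tuple : is_distr (duniform R (enum {: k.-tuple 'I_n})).
Proof. by apply: is_distr_uniform; rewrite -cardE card_tuple card_ord expn_gt0 n_gt0. Qed.

Lemma is_distr_send x : is_distr (send_distr x).
Proof.
apply: is_distr_bind => [|t]; last exact: is_distr_ret.
apply: is_distr_dseq => -[b|]; last exact: is_distr_ret.
by apply: is_distr_bind => [|t]; [apply: is_distr_uniform_tuple|apply: is_distr_ret].
Qed.

Lemma is_distr_round B c : is_distr (round R k l B c).
Proof.
apply: is_distr_bind => [|r]; last exact: is_distr_ret.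
apply: is_distr_dseq => u; rewrite /node_step.
case: ifP => [_|/norP[_]]; first exact: is_distr_ret.
rewrite -leqNgt => l_le; apply: is_distr_bind => [|S]; first exact: is_distr_draws.
by apply: is_distr_bind => [|t]; [apply: is_distr_uniform_tuple|apply: is_distr_ret].
Qed.

Lemma is_distr_run (adv : adversary n) T h c : is_distr (run R k l adv T h c).
Proof.
elim: T h c => [|T IH] h c /=; first exact: is_distr_ret.
by apply: is_distr_bind => [|c']; [apply: is_distr_round|apply: IH].
Qed.

Lemma is_distr_process (adv : adversary n) (x0 : 'I_n -> bool) T :
  is_distr (process R k l adv x0 T).
Proof.
apply: is_distr_bind => [|c]; last exact: is_distr_run.
apply: is_distr_bind => [|r]; last exact: is_distr_ret.
apply: is_distr_dseq => u.
by apply: is_distr_bind => [|t]; [apply: is_distr_uniform_tuple|apply: is_distr_ret].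
Qed.

Lemma is_distr_receive B bs w : is_distr (receive_distr B bs w).
Proof. by apply: is_distr_dseq => u; apply: is_distr_value_distr. Qed.

Lemma is_distr_value_kernel B x : is_distr (value_kernel B x).
Proof.
by apply: is_distr_bind => [|w]; [apply: is_distr_targets|apply: is_distr_receive].
Qed.

Lemma expect_uniform_tuple m f :
  expect (duniform R (enum {: m.-tuple 'I_n})) (fun ts => f (val ts)) =
  expect (dseq (nseq m uniform_node)) f.
Proof.
rewrite expect_uniform -cardE card_tuple card_ord big_enum /=.
elim: m f => [|m IH] f.
  rewrite expect_dseq0 expn0 invr1 mul1r (big_pred1 [tuple]) //.
  by move=> t; apply/esym/eqP; rewrite [t]tuple0.
rewrite [nseq _ _]/= expect_dseq_cons expect_uniform -cardE card_ord big_enum /=.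
under [in RHS]eq_bigr do rewrite -IH.
rewrite -mulr_sumr mulrA expnS natrM invfM; congr (_ * _).
rewrite pair_big /= (reindex (fun q : 'I_n * m.-tuple 'I_n => cons_tuple q.1 q.2)) //=.
exists (fun t => (thead t, behead_tuple t)) => [[a t] _|t _] /=.
  by congr (_, _); apply: val_inj.
by apply: val_inj; rewrite /= [in RHS](tuple_eta t).
Qed.

Lemma expect_addressed_messages x f :
  expect (dseq (map node_targets_distr x)) (fun t => f (addressed_messages (zip x t))) =
  expect (targets_distr (sent_values x)) (fun w => f (zip (sent_values x) w)).
Proof.
rewrite /targets_distr; elim: x f => [|[b|] x IH] f; first by rewrite !expect_dseq0.
  rewrite [sent_values _]/(nseq k b ++ sent_values x) map_cat expect_dseq_cat.
  rewrite [map node_targets_distr _]/= expect_dseq_cons expect_bind.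
  under eq_expect => ts do
    rewrite expect_ret (IH (fun r => f ([seq (b, t) | t <- val ts] ++ r))).
  rewrite (expect_uniform_tuple k (fun ts =>
    expect (dseq [seq uniform_node | _ <- sent_values x])
      (fun w => f ([seq (b, t) | t <- ts] ++ zip (sent_values x) w)))).
  rewrite map_nseq; apply: eq_expect_dseq => r; rewrite size_nseq => r_size.
  apply: eq_expect => w; rewrite zip_cat ?size_nseq//.
  by congr (f (_ ++ _)); rewrite -[in RHS]r_size; elim: r {r_size} => //= t r ->.
by rewrite [map node_targets_distr _]/= expect_dseq_cons expect_ret -IH.
Qed.

Lemma assemble_values x (t : seq (seq 'I_n)) (u : 'I_n) :
  size x = n -> size t = n -> (assemble (zip x t)).1 u = nth None x u.
Proof. by move=> x_size t_size /=; rewrite nth_zip ?x_size. Qed.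

Lemma assemble_inbox r v : size r = n -> (assemble r).2 v = inbox (addressed_messages r) v.
Proof.
move=> r_size.
pose sent_to (q : option bool * seq 'I_n) :=
  if q.1 is Some b then [seq b | t <- q.2 & t == v] else [::].
transitivity (flatten (map sent_to r)).
  by rewrite -[in RHS](mkseq_nth (None, [::]) r) r_size /mkseq -val_enum_ord -2!map_comp.
rewrite /inbox /addressed_messages filter_flatten map_flatten -!map_comp; congr flatten.
apply: eq_map => -[[b|] ts] //=.
by elim: ts => //= t ts; rewrite /sent_to /=; case: ifP => //= _ ->.
Qed.

Lemma expect_send_update B x f : size x = n ->
  expect (send_distr x) (fun c => expect (update_distr B c) f) = expect (value_kernel B x) f.
Proof.
move=> x_size; rewrite !expect_bind.
rewrite -(expect_addressed_messages x
  (fun r => expect (dseq [seq value_distr R l (u \in B) (inbox r u) | u <- enum 'I_n]) f)).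
apply: eq_expect_dseq => t; rewrite size_map => t_size; rewrite expect_ret /update_distr.
congr (expect (dseq _) f); apply: eq_map => u; rewrite assemble_inbox//.
by rewrite size_zip t_size minnn.
Qed.

Lemma expect_send_values x (f : config n -> R) (e : R) : size x = n ->
  (forall c : config n, (forall u : 'I_n, c.1 u = nth None x u) -> f c = e) ->
  expect (send_distr x) f = e.
Proof.
move=> x_size fe; rewrite -[RHS](expect_cst _ (is_distr_send x)) !expect_bind.
apply: eq_expect_dseq => t; rewrite size_map x_size => t_size.
by rewrite !expect_ret; apply: fe => u; apply: assemble_values.
Qed.

Lemma expect_round B c f :
  expect (round R k l B c) f = expect (update_distr B c) (fun x => expect (send_distr x) f).
Proof.
rewrite /round expect_bind /update_distr.
rewrite (eq_dseq_expect _ (k' := fun u => dbind (value_distr R l (u \in B) (c.2 u))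
   (fun o => dbind (node_targets_distr o) (fun t => dret R (o, t))))).
  rewrite expect_dseq_zip; apply: eq_expect => x; rewrite expect_bind.
  by apply: eq_expect => t; rewrite !expect_ret.
move=> u h; rewrite /node_step /value_distr; case: ifP => _.
  by rewrite expect_ret !expect_bind !expect_ret expect_bind !expect_ret.
rewrite !expect_bind; apply: eq_expect => S; rewrite expect_ret !expect_bind.
by apply: eq_expect => t; rewrite !expect_ret.
Qed.

Lemma expect_init_config (x0 : 'I_n -> bool) f :
  expect (init_config R k x0) f = expect (send_distr [seq Some (x0 u) | u <- enum 'I_n]) f.
Proof.
rewrite /init_config expect_bind.
rewrite (eq_dseq_expect _ (k' := fun u => dbind (dret R (Some (x0 u)))
   (fun o => dbind (node_targets_distr o) (fun t => dret R (o, t))))).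
  rewrite expect_dseq_zip expect_dseq_ret expect_bind.
  by apply: eq_expect => t; rewrite !expect_ret.
move=> u h; rewrite !expect_bind expect_ret !expect_bind; apply: eq_expect => t.
by rewrite !expect_ret.
Qed.

End Messages.

Section RoundStatistics.
Variables (R : realType) (n k l : nat).
Hypothesis n_gt0 : (0 < n)%N.
Variable B : {set 'I_n}.
Implicit Types (bs : seq bool) (w : seq 'I_n) (x : seq (option bool)) (v : 'I_n).
Implicit Types (f : option bool -> R) (psi : bool -> seq bool -> R).

Definition value_sum f x : R := \sum_(o <- x) f o.

Definition bias : seq (option bool) -> R := value_sum (@spin R).
Definition num_defined : seq (option bool) -> R := value_sum (@defined R).

Definition inbox_sum psi bs w : R :=
  \sum_(u <- enum 'I_n) psi (u \in B) (inbox (zip bs w) u).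

Definition node_mean f (blocked : bool) s : R := expect (value_distr R l blocked s) f.
Definition node_variance f (blocked : bool) s : R := variance (value_distr R l blocked s) f.

Lemma inbox_cons b t r v :
  inbox ((b, t) :: r) v = if t == v then b :: inbox r v else inbox r v.
Proof. by rewrite /inbox /=; case: ifP. Qed.

Lemma inbox_zip_redirect bs r1 r2 (a a' v : 'I_n) : a != v -> a' != v ->
  inbox (zip bs (r1 ++ a :: r2)) v = inbox (zip bs (r1 ++ a' :: r2)) v.
Proof.
move=> av a'v; elim: r1 bs => [|t r1 IH] [|b bs] //=; rewrite !inbox_cons ?IH//.
by rewrite (negbTE av) (negbTE a'v).
Qed.

(* Redirecting a message affects only the inboxes of its two addressees. *)
Lemma bounded_difference_inbox_sum c psi bs :
  (forall b s s', `|psi b s - psi b s'| <= c) ->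
  bounded_difference (2 * c) (inbox_sum psi bs).
Proof.
move=> psi_c r1 a a' r2; have c_ge0 : 0 <= c := le_trans (normr_ge0 _) (psi_c false [::] [::]).
rewrite /inbox_sum -sumrN -big_split /=.
apply: le_trans (ler_norm_sum _ _ _) _.
apply: (@le_trans _ _ (\sum_(u <- enum 'I_n) (c * (a == u)%:R + c * (a' == u)%:R))).
  apply: ler_sum => u _; have [_|au] := eqVneq a u.
    by apply: le_trans (psi_c _ _ _) _; rewrite mulr1 lerDl mulr_ge0.
  have [_|a'u] := eqVneq a' u; first by rewrite mulr0 add0r mulr1.
  by rewrite (inbox_zip_redirect _ _ _ au a'u) subrr normr0 !mulr0 addr0.
have sum_indicator (t : 'I_n) : \sum_(u in 'I_n) (t == u)%:R = 1 :> R.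
  by rewrite (bigD1 t) //= eqxx big1 ?addr0// => u; rewrite eq_sym => /negbTE ->.
by rewrite big_enum big_split -!mulr_sumr /= !sum_indicator; lra.
Qed.

Lemma norm_node_meanB_le c f b s s' :
  (forall o o', `|f o - f o'| <= c) -> `|node_mean f b s - node_mean f b s'| <= c.
Proof.
move=> fc; apply: norm_sub_expect_le => [|o]; first exact: is_distr_value_distr.
by rewrite distrC; apply: norm_sub_expect_le => //; apply: is_distr_value_distr.
Qed.

Lemma expect_receive_value_sum f bs w :
  expect (receive_distr R l B bs w) (value_sum f) = inbox_sum (node_mean f) bs w.
Proof. by rewrite expect_dseq_sum// => u; apply: is_distr_value_distr. Qed.

Lemma expect_kernel_value_sum f x (bs := sent_values k x) :
  expect (value_kernel R k l B x) (value_sum f) =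
  expect (targets_distr R n bs) (inbox_sum (node_mean f) bs).
Proof. by rewrite expect_bind; apply: eq_expect => w; rewrite expect_receive_value_sum. Qed.

Lemma variance_kernel_value_sum f x (bs := sent_values k x) :
  variance (value_kernel R k l B x) (value_sum f) =
  variance (targets_distr R n bs) (inbox_sum (node_mean f) bs) +
  expect (targets_distr R n bs) (inbox_sum (node_variance f) bs).
Proof.
rewrite variance_bind => [|w]; last exact: is_distr_receive.
congr (_ + _); first by apply: eq_central_moment => w; rewrite expect_receive_value_sum.
by apply: eq_expect => w; rewrite variance_dseq_sum// => u; apply: is_distr_value_distr.
Qed.

Section BoundedStatistic.
Variables (c : R) (f : option bool -> R) (x : seq (option bool)).
Hypothesis f_osc : forall o o', `|f o - f o'| <= c.
Let bs := sent_values k x.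

Lemma inbox_sum_mean_bounded_difference :
  bounded_difference (2 * c) (inbox_sum (node_mean f) bs).
Proof. by apply: bounded_difference_inbox_sum => b s s'; apply: norm_node_meanB_le. Qed.

Lemma variance_kernel_value_sum_le :
  variance (value_kernel R k l B x) (value_sum f) <=
  (size bs)%:R * (2 * c) ^+ 2 + n%:R * c ^+ 2.
Proof.
rewrite variance_kernel_value_sum; apply: lerD.
  apply: bounded_difference_variance_le inbox_sum_mean_bounded_difference => _.
  exact: is_distr_uniform_node.
apply: expect_le => [|w]; first exact: is_distr_targets.
rewrite /inbox_sum big_enum /= -[n in n%:R]card_ord mulr_natl -sumr_const.
apply: ler_sum => u _; apply: variance_le_sqr => [|o]; first exact: is_distr_value_distr.
by apply: norm_sub_expect_le => //; apply: is_distr_value_distr.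
Qed.

Lemma fourth_moment_kernel_value_sum_le :
  central_moment 4 (value_kernel R k l B x) (value_sum f) <=
  8 * (4 * (size bs)%:R ^+ 2 * (2 * c) ^+ 4 + 4 * n%:R ^+ 2 * c ^+ 4).
Proof.
apply: le_trans (fourth_moment_bind_le _ _ _) _; first exact: is_distr_targets.
  by move=> w; apply: is_distr_receive.
rewrite ler_pM2l//; apply: lerD.
  rewrite (eq_central_moment _ _ (expect_receive_value_sum f _)).
  apply: bounded_difference_fourth_moment_le inbox_sum_mean_bounded_difference => _.
  exact: is_distr_uniform_node.
apply: expect_le => [|w]; first exact: is_distr_targets.
rewrite -[X in X%:R ^+ 2](size_enum_ord n) /receive_distr.
apply: bounded_difference_fourth_moment_le => [u|].
  exact: is_distr_value_distr.
move=> r1 a a' r2; rewrite /value_sum !big_cat !big_cons /=.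
by rewrite [X in X - _]addrCA [X in _ - X]addrCA opprD addrACA subrr addr0.
Qed.

End BoundedStatistic.

Lemma expect_uniform_node_eq v (f : bool -> R) :
  expect (uniform_node R n) (fun t => f (t == v)) = expect (bernoulli n%:R^-1) f.
Proof.
rewrite expect_bernoulli.
transitivity (expect (uniform_node R n) (fun t => f false + (f true - f false) * (t == v)%:R)).
  by apply: eq_expect => t; case: (t == v) => /=; ring.
rewrite expectD expectZ expect_cst; last exact: is_distr_uniform_node.
rewrite expect_uniform -cardE card_ord big_enum /= (bigD1 v) //= eqxx big1 ?addr0.
  by rewrite mulr1; ring.
by move=> i /negbTE ->.
Qed.

Lemma expect_inbox bs v (F : nat -> nat -> R) (q : R := n%:R^-1) :
  expect (targets_distr R n bs)
    (fun w => F (count id (inbox (zip bs w) v)) (count negb (inbox (zip bs w) v))) =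
  expect (binom_distr q (count id bs)) (fun i =>
    expect (binom_distr q (count negb bs)) (F i)).
Proof.
rewrite /targets_distr; elim: bs F => [|b bs IH] F.
  by rewrite expect_dseq0 !expect_binom0.
rewrite [map _ _]/= expect_dseq_cons.
transitivity (expect (uniform_node R n) (fun t =>
  expect (binom_distr q (count id bs)) (fun i => expect (binom_distr q (count negb bs))
    (fun j => F ((t == v) && b + i)%N ((t == v) && ~~ b + j)%N)))).
  apply: eq_expect => t.
  rewrite -(IH (fun i j => F ((t == v) && b + i)%N ((t == v) && ~~ b + j)%N)).
  by apply: eq_expect => w; rewrite [zip _ _]/= inbox_cons; case: (t == v).
rewrite (expect_uniform_node_eq v (fun tv => expect (binom_distr q (count id bs)) (fun i =>
  expect (binom_distr q (count negb bs)) (fun j => F (tv && b + i)%N (tv && ~~ b + j)%N)))).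
rewrite expect_bernoulli; case: b => /=; first by rewrite expect_binomS.
by under [RHS]eq_expect do rewrite expect_binomS; rewrite expectD !expectZ.
Qed.

Lemma sum_unblocked (c : R) : \sum_(u <- enum 'I_n) (u \notin B)%:R * c = #|~: B|%:R * c.
Proof.
rewrite -mulr_suml big_enum /= -sum1_card natr_sum; congr (_ * _).
by rewrite [RHS]big_mkcond /=; apply: eq_bigr => u _; rewrite inE; case: (u \in B).
Qed.

Section BinomialInboxes.
Variable x : seq (option bool).
Let q : R := n%:R^-1.
Let bs := sent_values k x.

Lemma expect_kernel_num_defined :
  expect (value_kernel R k l B x) num_defined =
  #|~: B|%:R * prob (binom_distr q (size bs)) (fun m => l <= m)%N.
Proof.
rewrite expect_kernel_value_sum expect_sum -sum_unblocked; apply: eq_bigr => u _.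
rewrite prob_expect -count_id_negb -expect_binomD.
rewrite -(expect_inbox bs u (fun i j => (l <= i + j)%N%:R)) -expectZ.
apply: eq_expect => w; rewrite /node_mean expect_value_distr_defined count_id_negb.
by case: (u \in B); rewrite /= ?mul0r ?mul1r.
Qed.

Lemma expect_kernel_bias :
  expect (value_kernel R k l B x) bias =
  #|~: B|%:R * (draw_mean l (count id bs) (count negb bs) (majority_spin R l) *
                prob (binom_distr q (size bs)) (fun m => l <= m)%N).
Proof.
rewrite -count_id_negb -expect_binom_draw_mean expect_kernel_value_sum expect_sum.
rewrite -sum_unblocked; apply: eq_bigr => u _.
rewrite -(expect_inbox bs u (fun i j => draw_mean l i j (majority_spin R l))) -expectZ.
by apply: eq_expect => w; rewrite /node_mean expect_value_distr_spin.
Qed.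

(* An inbox with as many ones as zeros makes its node a fair coin. *)
Lemma variance_kernel_bias_ge m : odd l -> (l <= m + m)%N ->
  #|~: B|%:R * (prob (binom_distr q (count id bs)) (pred1 m) *
                prob (binom_distr q (count negb bs)) (pred1 m)) <=
  variance (value_kernel R k l B x) bias.
Proof.
move=> l_odd lm; rewrite variance_kernel_value_sum -[leLHS]add0r; apply: lerD.
  by apply: central_moment_ge0 => //; apply: is_distr_targets.
rewrite -sum_unblocked /inbox_sum expect_sum; apply: ler_sum => u _.
rewrite !prob_expect [X in _ * X]mulrC -expectZ.
under [X in _ * X]eq_expect do rewrite mulrC -expectZ.
rewrite -(expect_inbox bs u (fun i j => (i == m)%:R * (j == m)%:R)) -expectZ.
apply: ler_expect => [|w]; first exact: is_distr_targets.
set s := inbox _ _; rewrite /node_variance.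
have sP : is_distr (value_distr R l (u \in B) s) by apply: is_distr_value_distr.
have var_ge0 := central_moment_ge0 (@spin R) (isT : ~~ odd 2) sP.
have [im|_] := eqVneq (count id s) m; last by rewrite mul0r mulr0.
have [jm|_] := eqVneq (count negb s) m; last by rewrite !mulr0.
rewrite varianceE//; under eq_expect do rewrite spin_sqr.
rewrite expect_value_distr_defined expect_value_distr_spin -count_id_negb im jm lm.
have -> : draw_mean l m m (majority_spin R l) = 0.
  have /eqP := draw_mean_antisym m m (fun r => @majority_spin_antisym R l r l_odd).
  by rewrite -addr_eq0 -mulr2n mulrn_eq0 => /eqP.
by rewrite andbT mulr0 expr0n subr0 !mulr1.
Qed.

End BinomialInboxes.
End RoundStatistics.

Section ExponentialBounds.
Variable R : realType.
Implicit Types (x : R) (m n k M A : nat).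

Lemma series_exp_coeff_le_expR x m : 0 <= x -> series (exp_coeff x) m <= expR x.
Proof.
move=> x_ge0; apply: nondecreasing_cvgn_le; last exact: is_cvg_series_exp_coeff.
by apply/nondecreasing_seqP => j; rewrite seriesSr lerDl exp_coeff_ge0.
Qed.

Lemma expRN1_le : expR (-1) <= 10 / 27 :> R.
Proof.
have e_ge : 27 / 10 <= expR 1 :> R.
  apply: le_trans (series_exp_coeff_le_expR 5 ler01).
  rewrite /series /= 5?big_nat_recr//= big_nil /exp_coeff /= !expr1n fact0.
  by rewrite (_ : 4`! = 24)%N// (_ : 3`! = 6)%N// (_ : 2`! = 2)%N// (_ : 1`! = 1)%N//; lra.
by rewrite expRN -[leRHS]invrK lef_pV2 ?posrE ?expR_gt0 ?invf_div; lra.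
Qed.

Lemma expRN2x_le x : 0 <= x <= 1 / 2 -> expR (- (2 * x)) <= 1 - x.
Proof.
move=> /andP[x_ge0 x_le]; rewrite expRN -div1r ler_pdivrMr ?expR_gt0//.
apply: (@le_trans _ _ ((1 - x) * (1 + 2 * x))); first by nra.
by apply: ler_wpM2l; [lra|apply: expR_ge1Dx].
Qed.

Section InverseSize.
Variable n : nat.
Hypothesis n_ge : (1000 <= n)%N.
Let q : R := n%:R^-1.

Lemma natr_ge1000 : 1000 <= n%:R :> R. Proof. by rewrite ler_nat. Qed.

Lemma natr_inv_bounds : 0 < q <= 1 / 1000.
Proof.
have n_ge1000 := natr_ge1000; have n_gt0 : 0 < n%:R :> R by lra.
by rewrite /q invr_gt0 n_gt0 div1r lef_pV2 ?posrE//; lra.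
Qed.

Lemma mulr_natr_inv : n%:R * q = 1.
Proof. by rewrite divff// pnatr_eq0 -lt0n (leq_trans _ n_ge). Qed.

Lemma expRN_le_pow k : expR (- (2 * k%:R)) <= (1 - q) ^+ (k * n).
Proof.
have q_bounds := natr_inv_bounds.
have -> : - (2 * k%:R) = (k * n)%:R * - (2 * q) :> R.
  by rewrite natrM mulrN mulrCA -mulrA mulr_natr_inv mulr1.
rewrite expRM_natl lerXn2r ?nnegrE ?expR_ge0//; first lra.
by apply: expRN2x_le; lra.
Qed.

(* 10/27 bounds exp(-1) and 1000/999 bounds 1/(1 - 1/n). *)
Lemma prob_binom_ge3_ge k M : (k * n <= M)%N ->
  1 - (10 / 27) ^+ k * (1 + k%:R * (1000 / 999) + (k%:R * (1000 / 999)) ^+ 2 / 2) <=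
  prob (binom_distr q M) (fun m => 3 <= m)%N.
Proof.
move=> knM; have q_bounds := natr_inv_bounds; have q01 : 0 <= q < 1 by lra.
rewrite prob_binom_ge; last lra; rewrite lerD2l lerN2.
apply: le_trans (prob_binom_lt_anti _ 3 knM) _; first lra.
apply: le_trans (prob_binom_lt_le_poisson (k * n) 3 q01) _.
rewrite natrM -mulrA mulr_natr_inv mulr1 !big_ord_recr big_ord0 /= expr0 expr1.
rewrite add0r fact0 !divr1 (_ : 2`! = 2)%N//.
have y_le : k%:R / (1 - q) <= k%:R * (1000 / 999).
  by rewrite ler_wpM2l// -[leRHS]invrK lef_pV2 ?posrE ?invf_div//; lra.
have y_ge0 : 0 <= k%:R / (1 - q) by rewrite divr_ge0//; lra.
apply: ler_pM; rewrite ?expR_ge0//.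
- by rewrite addr_ge0 ?addr_ge0// divr_ge0 ?sqr_ge0.
- by rewrite -mulrN1 expRM_natl lerXn2r ?nnegrE ?expR_ge0 ?expRN1_le ?divr_ge0.
- by rewrite !lerD// ler_pM2r ?invr_gt0// lerXn2r ?nnegrE// (le_trans y_ge0).
Qed.

Lemma prob_binom_eq2_ge A : 4 / 5 * n%:R <= A%:R :> R ->
  3 / 10 * (1 - q) ^+ (A - 2) <= prob (binom_distr q A) (pred1 2%N).
Proof.
move=> A_ge; have q_bounds := natr_inv_bounds; have nq := mulr_natr_inv.
rewrite prob_binom_eq; apply: ler_wpM2r; first by rewrite exprn_ge0//; lra.
have Aq_ge : 4 / 5 <= A%:R * q.
  have q_ge0 : 0 <= q by lra.
  by have := ler_wpM2r q_ge0 A_ge; rewrite -[_ * _ * q]mulrA nq mulr1.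
have -> : 'C(A, 2)%:R * q ^+ 2 = (A%:R * q) * (A%:R * q - q) / 2.
  by rewrite natr_bin2; field.
have : 4 / 5 * (4 / 5 - 1 / 1000) <= (A%:R * q) * (A%:R * q - q) by rewrite ler_pM//; lra.
lra.
Qed.

End InverseSize.
End ExponentialBounds.

Section MajorityDrift.
Variable R : realType.
Implicit Types u v z Q : R.

(* Mean of the majority of three independent votes of mean [u]. *)
Definition majority_drift u : R := (3 * u - u ^+ 3) / 2.

Lemma majority_drift0 : majority_drift 0 = 0.
Proof. by rewrite /majority_drift expr0n mulr0 subrr mul0r. Qed.

Lemma ler_majority_drift u v : 0 <= u -> u <= v -> v <= 1 ->
  majority_drift u <= majority_drift v.
Proof.
move=> u_ge0 uv v_le1; rewrite /majority_drift ler_pM2r ?invr_gt0// -subr_ge0.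
have -> : 3 * v - v ^+ 3 - (3 * u - u ^+ 3) =
  (v - u) * ((1 - v ^+ 2) + (1 - u * v) + (1 - u ^+ 2)) by ring.
have v_ge0 := le_trans u_ge0 uv; have u_le1 := le_trans uv v_le1.
have v2 : v ^+ 2 <= 1 by rewrite exprn_ile1.
have u2 : u ^+ 2 <= 1 by rewrite exprn_ile1.
have uv_le1 : u * v <= 1 by rewrite mulr_ile1.
by rewrite mulr_ge0//; lra.
Qed.

(* Drawing without replacement only increases the drift. *)
Lemma majority_drift_le_draw_mean (i j : nat) : (3 <= i + j)%N ->
  majority_drift (`|i%:R - j%:R| / (i%:R + j%:R)) <=
  `|draw_mean 3 i j (majority_spin R 3)|.
Proof.
rewrite -(ler_nat R) natrD draw_mean_majority3; set m := i%:R + j%:R => m_ge3.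
have ij_ge0 : 0 <= i%:R * j%:R :> R by rewrite mulr_ge0.
have m_gt0 : 0 < m by lra.
have D_gt0 : 0 < (m - 1) * (m - 2) by rewrite mulr_gt0; lra.
set y := i%:R - j%:R.
have -> : majority_drift (`|y| / m) = `|y| / m * (1 + 2 * (i%:R * j%:R) / m ^+ 2).
  have y2 : `|y| ^+ 2 = m ^+ 2 - 4 * (i%:R * j%:R).
    by rewrite real_normK ?num_real// /y /m; ring.
  rewrite /majority_drift.
  have -> : 3 * (`|y| / m) - (`|y| / m) ^+ 3 = `|y| / m * (3 - `|y| ^+ 2 / m ^+ 2).
    by rewrite exprMn exprVn; field; rewrite gt_eqF.
  by rewrite y2; field; rewrite gt_eqF.
have -> : y * ((m - 1) * (m - 2) + 2 * i%:R * j%:R) / (m * (m - 1) * (m - 2)) =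
    y / m * (1 + 2 * (i%:R * j%:R) / ((m - 1) * (m - 2))).
  by field; rewrite !gt_eqF//; lra.
have amplification_ge0 : 0 <= 1 + 2 * (i%:R * j%:R) / ((m - 1) * (m - 2)).
  by rewrite addr_ge0// divr_ge0 ?(ltW D_gt0)// mulr_ge0.
rewrite normrM normrM normfV (gtr0_norm m_gt0) (ger0_norm amplification_ge0).
rewrite ler_wpM2l ?divr_ge0 ?(ltW m_gt0)// lerD2l ler_wpM2l ?mulr_ge0//.
by rewrite lef_pV2 ?posrE ?exprn_gt0//; nra.
Qed.

(* [v] is the fraction of defined nodes and [Q] the probability that an inbox has
   at least three messages. *)
Lemma majority_drift_growth v z Q : 2 / 3 <= v <= 1 -> 0 <= z <= 2 / 5 ->
  3 / 4 <= Q -> (5 / 6 <= v -> 43 / 50 <= Q) ->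
  11 / 10 * z <= 15 / 16 * Q * majority_drift (z / v).
Proof.
move=> /andP[v_ge v_le] /andP[z_ge0 z_le] Q_ge Q_ge'.
have v_gt0 : 0 < v by lra.
have -> : 15 / 16 * Q * majority_drift (z / v) =
    z * (15 / 16 * Q * (3 * v ^+ 2 - z ^+ 2)) / (2 * v ^+ 3).
  by rewrite /majority_drift; field; rewrite gt_eqF.
rewrite ler_pdivlMr; last by rewrite mulr_gt0 ?exprn_gt0.
rewrite [leLHS](_ : _ = z * (11 / 5 * v ^+ 3)); last by field.
apply: ler_wpM2l => //.
have z2 : z ^+ 2 <= 4 / 25 by nra.
have v2 : 4 / 9 <= v ^+ 2 by nra.
apply: (@le_trans _ _ (15 / 16 * Q * (3 * v ^+ 2 - 4 / 25))); last first.
  by apply: ler_wpM2l; lra.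
have [v56|v56] := lerP v (5 / 6).
  apply: (@le_trans _ _ (45 / 64 * (3 * v ^+ 2 - 4 / 25))); last first.
    by apply: ler_wpM2r; lra.
  have : 0 <= (v - 2 / 3) * (5 / 6 - v) * v by rewrite !mulr_ge0//; lra.
  have : 0 <= (v - 2 / 3) * (5 / 6 - v) by rewrite mulr_ge0//; lra.
  lra.
apply: (@le_trans _ _ (129 / 160 * (3 * v ^+ 2 - 4 / 25))); last first.
  by apply: ler_wpM2r; [|have := Q_ge' (ltW v56)]; lra.
have : 0 <= (v - 5 / 6) * (1 - v) * v by rewrite !mulr_ge0//; lra.
have : 0 <= (v - 5 / 6) * (1 - v) by rewrite mulr_ge0//; lra.
lra.
Qed.

End MajorityDrift.

Section ValueCounts.
Variable R : realType.
Implicit Types x : seq (option bool).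

Lemma count_sent_ones k x : count id (sent_values k x) = (k * count_mem (Some true) x)%N.
Proof.
elim: x => [|o x IH]; first by rewrite muln0.
rewrite /sent_values /= count_cat IH mulnDr; congr (_ + _)%N.
by case: o => [[]|] /=; rewrite ?count_nseq ?muln0// mulnC.
Qed.

Lemma count_sent_zeros k x : count negb (sent_values k x) = (k * count_mem (Some false) x)%N.
Proof.
elim: x => [|o x IH]; first by rewrite muln0.
rewrite /sent_values /= count_cat IH mulnDr; congr (_ + _)%N.
by case: o => [[]|] /=; rewrite ?count_nseq ?muln0// mulnC.
Qed.

Lemma biasE x : bias R x = (count_mem (Some true) x)%:R - (count_mem (Some false) x)%:R.
Proof.
rewrite /bias /value_sum; elim: x => [|o x IH]; first by rewrite big_nil subrr.
by rewrite big_cons IH /= !natrD; case: o => [[]|] /=; ring.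
Qed.

Lemma num_definedE x :
  num_defined R x = (count_mem (Some true) x)%:R + (count_mem (Some false) x)%:R.
Proof.
rewrite /num_defined /value_sum; elim: x => [|o x IH]; first by rewrite big_nil addr0.
by rewrite big_cons IH /= !natrD; case: o => [[]|]; rewrite /defined /=; ring.
Qed.

Lemma size_sent_values k x : (size (sent_values k x))%:R = k%:R * num_defined R x.
Proof.
by rewrite -count_id_negb count_sent_ones count_sent_zeros num_definedE natrD !natrM mulrDr.
Qed.

Lemma num_defined_le_size x : num_defined R x <= (size x)%:R.
Proof.
rewrite /num_defined /value_sum -sum1_size natr_sum; apply: ler_sum => o _.
by rewrite ler_nat; case: o.
Qed.

Lemma norm_bias_le_num_defined x : `|bias R x| <= num_defined R x.
Proof. by rewrite biasE num_definedE (le_trans (ler_normB _ _))// !ger0_norm. Qed.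

Lemma norm_spinB_le o o' : `|spin R o - spin R o'| <= 2.
Proof.
apply: le_trans (ler_normB _ _) _.
by have := norm_spin_le1 R o; have := norm_spin_le1 R o'; lra.
Qed.

Lemma norm_definedB_le o o' : `|defined R o - defined R o'| <= 1.
Proof.
by rewrite /defined; case: (isSome o) (isSome o') => -[];
   rewrite ?subrr ?subr0 ?sub0r ?normrN ?normr0 ?normr1.
Qed.

Lemma majority_drift_le_draw_mean_sent k x (s := sent_values k x) :
  (0 < k)%N -> (3 <= size s)%N ->
  majority_drift (`|bias R x| / num_defined R x) <=
  `|draw_mean 3 (count id s) (count negb s) (majority_spin R 3)|.
Proof.
move=> k_gt0 s_ge3; rewrite -count_id_negb in s_ge3.
apply: le_trans (majority_drift_le_draw_mean R s_ge3).
rewrite count_sent_ones count_sent_zeros !natrM -mulrBr -mulrDr -biasE -num_definedE.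
by rewrite normrM ger0_norm// -mulf_div divff ?mul1r// pnatr_eq0 -lt0n.
Qed.

End ValueCounts.

Definition populated (R : realType) (n : nat) x : bool := 2 / 3 * n%:R <= num_defined R x.
Definition polarized (R : realType) (n : nat) x : bool := 2 / 5 * n%:R <= `|bias R x|.

(* From [fourth_moment_kernel_value_sum_le], for [c = 2] and at most [6 n] messages. *)
Definition bias_fourth_cst (R : realType) : R := 8 * (4 * 6 ^+ 2 * 4 ^+ 4 + 4 * 2 ^+ 4).
Definition noise (R : realType) : R := expR (-12) / 20.

Definition depolarization_error (R : realType) (n : nat) : R :=
  25 ^+ 4 * bias_fourth_cst R / n%:R ^+ 2.
Definition depopulation_error (R : realType) (n : nat) : R := 25 * 32 ^+ 2 / n%:R.

Section OneRound.
Variables (R : realType) (n : nat) (B : {set 'I_n}) (x : seq (option bool)).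
Hypothesis n_ge : (1000 <= n)%N.
Hypothesis B_le : #|B|%:R <= 1 / 16 * n%:R :> R.
Hypothesis x_size : size x = n.
Hypothesis x_populated : populated R n x.

Let n_gt0 : (0 < n)%N. Proof. exact: leq_trans n_ge. Qed.
Let N_gt0 : 0 < n%:R :> R. Proof. by rewrite ltr0n. Qed.
Let q : R := n%:R^-1.
Let kernel := value_kernel R 6 3 B x.
Let update_prob : R := prob (binom_distr q (size (sent_values 6 x))) (fun m => 3 <= m)%N.

Let kernelP : is_distr kernel. Proof. exact: is_distr_value_kernel. Qed.

Lemma card_unblocked_ge : 15 / 16 * n%:R <= #|~: B|%:R :> R.
Proof.
have : #|B|%:R + #|~: B|%:R = n%:R :> R by rewrite -natrD cardsC card_ord.
by move: B_le; lra.
Qed.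

Lemma num_defined_le : num_defined R x <= n%:R.
Proof. by rewrite -[in leRHS]x_size num_defined_le_size. Qed.

Lemma size_sent_values_le : (size (sent_values 6 x))%:R <= 6 * n%:R :> R.
Proof. by rewrite size_sent_values ler_pM2l// num_defined_le. Qed.

Lemma leq_size_sent_values (k : nat) :
  k%:R / 6 * n%:R <= num_defined R x -> (k * n <= size (sent_values 6 x))%N.
Proof. by move=> kn; rewrite -(ler_nat R) natrM size_sent_values; lra. Qed.

Lemma update_prob_ge : 3 / 4 <= update_prob.
Proof.
have size_ge : (4 * n <= size (sent_values 6 x))%N.
  by apply: leq_size_sent_values; move: x_populated; rewrite /populated; lra.
by apply: le_trans (prob_binom_ge3_ge R n_ge size_ge); lra.
Qed.

Lemma update_prob_ge_crowded : 5 / 6 * n%:R <= num_defined R x -> 43 / 50 <= update_prob.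
Proof.
move=> /leq_size_sent_values size_ge.
by apply: le_trans (prob_binom_ge3_ge R n_ge size_ge); lra.
Qed.

Lemma unblocked_update_ge : 15 / 16 * n%:R * update_prob <= #|~: B|%:R * update_prob.
Proof. by apply: ler_wpM2r card_unblocked_ge; have := update_prob_ge; lra. Qed.

Lemma num_defined_variance_le : variance kernel (@num_defined R) <= 25 * n%:R.
Proof.
apply: le_trans (variance_kernel_value_sum_le _ _ n_gt0 _ _ (@norm_definedB_le R)) _.
by have := size_sent_values_le; lra.
Qed.

Lemma bias_variance_le : variance kernel (@bias R) <= 100 * n%:R.
Proof.
apply: le_trans (variance_kernel_value_sum_le _ _ n_gt0 _ _ (@norm_spinB_le R)) _.
by have := size_sent_values_le; lra.
Qed.

Lemma bias_fourth_moment_le :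
  central_moment 4 kernel (@bias R) <= bias_fourth_cst R * n%:R ^+ 2.
Proof.
apply: le_trans (fourth_moment_kernel_value_sum_le _ _ n_gt0 _ _ (@norm_spinB_le R)) _.
have size2_le : (size (sent_values 6 x))%:R ^+ 2 <= (6 * n%:R) ^+ 2 :> R.
  by rewrite lerXn2r ?nnegrE ?mulr_ge0// size_sent_values_le.
rewrite /bias_fourth_cst; lra.
Qed.

Lemma kernel_not_populated_le :
  prob kernel (fun y => ~~ populated R n y) <= depopulation_error R n.
Proof.
have mean_ge : 45 / 64 * n%:R <= expect kernel (@num_defined R).
  rewrite expect_kernel_num_defined//; apply: le_trans unblocked_update_ge.
  by have := ler_wpM2l (ltW N_gt0) update_prob_ge; lra.
have t_gt0 : 0 < n%:R / 32 :> R by rewrite divr_gt0.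
apply: le_trans (_ : variance kernel (@num_defined R) / (n%:R / 32) ^+ 2 <= _).
  apply: le_trans (chebyshev _ (isT : ~~ odd 2) kernelP t_gt0).
  apply: ler_prob => // y; rewrite -ltNge /populated => few.
  by rewrite distrC ler_normr; apply/orP; left; lra.
rewrite ler_pdivrMr ?exprn_gt0//.
have -> : depopulation_error R n * (n%:R / 32) ^+ 2 = 25 * n%:R.
  by rewrite /depopulation_error; field; rewrite gt_eqF.
exact: num_defined_variance_le.
Qed.

Lemma norm_expect_bias_ge :
  11 / 10 * Num.min `|bias R x| (2 / 5 * n%:R) <= `|expect kernel (@bias R)|.
Proof.
set d := num_defined R x; set y := `|bias R x|; set Y := Num.min _ _.
have d_ge : 2 / 3 * n%:R <= d := x_populated; have d_le : d <= n%:R := num_defined_le.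
have d_gt0 : 0 < d by move: N_gt0; lra.
have y_le : y <= d := norm_bias_le_num_defined R x.
have Yy : Y <= y by rewrite ge_min lexx.
have Y_le : Y <= 2 / 5 * n%:R by rewrite ge_min lexx orbT.
have Y_ge0 : 0 <= Y by rewrite le_min normr_ge0 /= mulr_ge0 ?divr_ge0 ?(ltW N_gt0).
have drift : majority_drift (Y / d) <= `|draw_mean 3 (count id (sent_values 6 x))
    (count negb (sent_values 6 x)) (majority_spin R 3)|.
  apply: le_trans (@majority_drift_le_draw_mean_sent R 6 x isT _); last first.
    by rewrite -(ler_nat R) size_sent_values -/d; have := natr_ge1000 R n_ge; lra.
  by apply: ler_majority_drift; rewrite ?divr_ge0 ?ler_pM2r ?invr_gt0 ?ler_pdivrMr ?mul1r// ltW.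
have v_bounds : 2 / 3 <= d / n%:R <= 1 by rewrite ler_pdivlMr// ler_pdivrMr// mul1r d_ge.
have z_bounds : 0 <= Y / n%:R <= 2 / 5 by rewrite divr_ge0//= ler_pdivrMr.
have crowded : 5 / 6 <= d / n%:R -> 43 / 50 <= update_prob.
  by rewrite ler_pdivlMr//; apply: update_prob_ge_crowded.
have := majority_drift_growth v_bounds z_bounds update_prob_ge crowded.
have -> : Y / n%:R / (d / n%:R) = Y / d by field; rewrite !gt_eqF.
rewrite [X in X <= _ -> _]mulrA ler_pdivrMr// => growth; apply: le_trans growth _.
have Q_ge0 : 0 <= update_prob by have := update_prob_ge; lra.
have drift_ge0 : 0 <= majority_drift (Y / d).
  rewrite -[leLHS](majority_drift0 R); apply: ler_majority_drift => //.
    by rewrite divr_ge0 ?(ltW d_gt0).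
  by rewrite ler_pdivrMr// mul1r (le_trans Yy).
rewrite expect_kernel_bias// -/update_prob normrM [`|_ * update_prob|]normrM.
rewrite ger0_norm// (ger0_norm Q_ge0).
rewrite mulrAC [X in _ <= _ * X]mulrC [leRHS]mulrA.
apply: ler_pM drift => //; last by rewrite mulrAC unblocked_update_ge.
by rewrite !mulr_ge0 ?invr_ge0.
Qed.

Lemma kernel_not_polarized_le : polarized R n x ->
  prob kernel (fun y => ~~ polarized R n y) <= depolarization_error R n.
Proof.
move=> x_polarized; have := norm_expect_bias_ge; rewrite (min_r x_polarized) => mean_ge.
have t_gt0 : 0 < n%:R / 25 :> R by rewrite divr_gt0.
apply: le_trans (_ : central_moment 4 kernel (@bias R) / (n%:R / 25) ^+ 4 <= _).
  apply: le_trans (chebyshev _ (isT : ~~ odd 4) kernelP t_gt0).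
  apply: ler_prob => // y; rewrite -ltNge /polarized => small.
  have := lerB_dist (expect kernel (@bias R)) (bias R y); rewrite distrC; lra.
rewrite ler_pdivrMr ?exprn_gt0//.
have -> : depolarization_error R n * (n%:R / 25) ^+ 4 = bias_fourth_cst R * n%:R ^+ 2.
  by rewrite /depolarization_error; field; rewrite gt_eqF.
exact: bias_fourth_moment_le.
Qed.

Lemma bias_variance_ge : ~~ polarized R n x ->
  noise R * n%:R <= variance kernel (@bias R).
Proof.
rewrite -ltNge => small.
apply: le_trans (variance_kernel_bias_ge R 6 n_gt0 B x (isT : odd 3) (isT : 3 <= 2 + 2)%N).
set ones := count id (sent_values 6 x); set zeros := count negb (sent_values 6 x).
rewrite -/q; have q_bounds := natr_inv_bounds R n_ge; rewrite -/q in q_bounds.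
move: small x_populated; rewrite ltr_norml /populated biasE num_definedE => small pop.
have ones_ge : 3 / 10 * (1 - q) ^+ (ones - 2) <= prob (binom_distr q ones) (pred1 2%N).
  by apply: prob_binom_eq2_ge => //; rewrite /ones count_sent_ones natrM; lra.
have zeros_ge : 3 / 10 * (1 - q) ^+ (zeros - 2) <= prob (binom_distr q zeros) (pred1 2%N).
  by apply: prob_binom_eq2_ge => //; rewrite /zeros count_sent_zeros natrM; lra.
have pow_ge : expR (-12) <= (1 - q) ^+ (ones - 2) * (1 - q) ^+ (zeros - 2).
  have -> : -12 = - (2 * 6) :> R by ring.
  apply: le_trans (expRN_le_pow R n_ge 6) _.
  rewrite -/q -exprD ler_wiXn2l//; [lra|lra|].
  apply: (@leq_trans (ones + zeros)); first by apply: leq_add; apply: leq_subr.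
  by rewrite count_id_negb -(ler_nat R) natrM size_sent_values_le.
have pow_ge0 m : 0 <= 3 / 10 * (1 - q) ^+ m by rewrite mulr_ge0 ?exprn_ge0//; lra.
have prod_ge := ler_pM (pow_ge0 _) (pow_ge0 _) ones_ge zeros_ge.
have e_gt0 := expR_gt0 (-12 : R).
apply: le_trans (_ : 15 / 16 * n%:R * (9 / 100 * expR (-12)) <= _).
  by rewrite /noise; nra.
apply: ler_pM card_unblocked_ge _; [lra|lra|].
by apply: le_trans prod_ge; lra.
Qed.

End OneRound.

Section InverseQuadratic.
Variable R : realType.

Lemma invrD_le (Q s : R) : 0 < Q -> 1 <= Q + s -> (Q + s)^-1 <= (Q - s + s ^+ 2) / Q ^+ 2.
Proof.
move=> Q_gt0 Qs_ge1; have Qs_gt0 : 0 < Q + s by lra.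
rewrite ler_pdivlMr ?exprn_gt0// ler_pdivrMl//.
have -> : (Q + s) * (Q - s + s ^+ 2) = Q ^+ 2 + s ^+ 2 * (Q + s - 1) by ring.
by rewrite lerDl mulr_ge0 ?sqr_ge0// subr_ge0.
Qed.

Section ExpectedInverseQuadratic.
Variables (A : Type) (d : dist R A) (Y : A -> R) (e : R).
Hypotheses (dP : is_distr d) (e_ge0 : 0 <= e).
Let mu : R := expect d Y.
Let Q : R := 1 + e * mu ^+ 2.

Lemma expect_inv_quadratic_le :
  expect d (fun a => (1 + e * Y a ^+ 2)^-1) <=
  (Q - e * variance d Y + 8 * (e * mu ^+ 2) * (e * variance d Y)
     + 2 * (e ^+ 2 * central_moment 4 d Y)) / Q ^+ 2.
Proof.
have Q_gt0 : 0 < Q by rewrite ltr_pwDl// mulr_ge0 ?sqr_ge0.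
have -> : Q - e * variance d Y + 8 * (e * mu ^+ 2) * (e * variance d Y)
     + 2 * (e ^+ 2 * central_moment 4 d Y) =
  expect d (fun a => Q + (- 2 * e * mu) * (Y a - mu)
     + (8 * e ^+ 2 * mu ^+ 2 - e) * (Y a - mu) ^+ 2 + (2 * e ^+ 2) * (Y a - mu) ^+ 4).
  rewrite 3!expectD expect_cst// (expectZ d (- 2 * e * mu) (fun a => Y a - mu)).
  rewrite (expectZ d _ (fun a => (Y a - mu) ^+ 2)) (expectZ d _ (fun a => (Y a - mu) ^+ 4)).
  by rewrite expect_centered// /variance /central_moment -/mu; ring.
rewrite mulrC -expectZ; apply: ler_expect => // a; set D := Y a - mu.
set s := e * (2 * mu * D + D ^+ 2).
have YE : 1 + e * Y a ^+ 2 = Q + s by rewrite /Q /s /D; ring.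
have Qs_ge1 : 1 <= Q + s by rewrite -YE lerDl mulr_ge0 ?sqr_ge0.
rewrite YE mulrC; apply: le_trans (invrD_le Q_gt0 Qs_ge1) _.
rewrite ler_pM2r ?invr_gt0 ?exprn_gt0//.
have -> : Q + - 2 * e * mu * D + (8 * e ^+ 2 * mu ^+ 2 - e) * D ^+ 2 + 2 * e ^+ 2 * D ^+ 4 =
  Q - s + s ^+ 2 + e ^+ 2 * (2 * mu * D - D ^+ 2) ^+ 2 by rewrite /s; ring.
by rewrite lerDl mulr_ge0 ?sqr_ge0.
Qed.

End ExpectedInverseQuadratic.

(* Here [u] and [z] are the rescaled squares of the mean bias and of the old bias,
   and [P] and [W] the rescaled variance and fourth central moment. Noise gains
   the factor when [u] is small and drift when [u] is large. *)
Lemma noise_or_drift_gain (u z P W : R) : 0 <= z -> 121 / 100 * z <= u ->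
  0 <= P <= 1 / 2000 -> W <= P / 8 ->
  (1 + u - P + 8 * u * P + 2 * W) * (1 + z) <= (1 - P / 5) * (1 + u) ^+ 2.
Proof.
move=> z_ge0 zu /andP[P_ge0 P_le] WP; have u_ge0 : 0 <= u by lra.
have uP_ge0 : 0 <= u * P by apply: mulr_ge0.
apply: (@le_trans _ _ ((1 + u - 3 / 4 * P + 8 * u * P) * (1 + 100 / 121 * u))).
  apply: (@le_trans _ _ ((1 + u - 3 / 4 * P + 8 * u * P) * (1 + z))).
    by apply: ler_wpM2r; lra.
  by apply: ler_wpM2l; lra.
have [u_small|u_large] := lerP u (1 / 16).
  have uP : u * P <= 1 / 16 * P by apply: ler_wpM2r.
  apply: (@le_trans _ _ ((1 + u - P / 4) * (1 + u))).
    apply: (@le_trans _ _ ((1 + u - P / 4) * (1 + 100 / 121 * u))).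
      by apply: ler_wpM2r; lra.
    by apply: ler_wpM2l; lra.
  have : 0 <= (1 + u) * P * (1 / 16 - u) by rewrite !mulr_ge0//; lra.
  have : 0 <= (1 + u) * P by rewrite mulr_ge0//; lra.
  lra.
apply: (@le_trans _ _ ((1 + u) * (1 + 8 * P) * (1 + 100 / 121 * u))).
  by apply: ler_wpM2r; lra.
have -> : (1 - P / 5) * (1 + u) ^+ 2 = (1 + u) * ((1 - P / 5) * (1 + u)) by ring.
rewrite -mulrA; apply: ler_wpM2l; first by lra.
have uP : u * P <= u * (1 / 2000) by apply: ler_wpM2l.
lra.
Qed.

Lemma expect_inv_quadratic_contract A (d : dist R A) (Y : A -> R) (e y gain : R) :
  is_distr d -> 0 <= e -> gain <= e * variance d Y -> e * variance d Y <= 1 / 2000 ->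
  e ^+ 2 * central_moment 4 d Y <= e * variance d Y / 8 ->
  11 / 10 * `|y| <= `|expect d Y| ->
  expect d (fun a => (1 + e * Y a ^+ 2)^-1) <= (1 - gain / 5) / (1 + e * y ^+ 2).
Proof.
move=> dP e_ge0 gain_le var_le fourth_le drift.
have P_ge0 : 0 <= e * variance d Y by rewrite mulr_ge0 ?central_moment_ge0.
have z_ge0 : 0 <= e * y ^+ 2 by rewrite mulr_ge0 ?sqr_ge0.
have drift2 : 121 / 100 * (e * y ^+ 2) <= e * expect d Y ^+ 2.
  rewrite mulrCA ler_wpM2l// -[y ^+ 2]real_normK ?num_real//.
  rewrite -[expect d Y ^+ 2]real_normK ?num_real//.
  have -> : 121 / 100 * `|y| ^+ 2 = (11 / 10 * `|y|) ^+ 2 by field.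
  by rewrite lerXn2r ?nnegrE ?mulr_ge0 ?invr_ge0.
have P_bounds : 0 <= e * variance d Y <= 1 / 2000 by rewrite P_ge0.
have Q_gt0 : 0 < 1 + e * expect d Y ^+ 2 by lra.
apply: le_trans (expect_inv_quadratic_le Y dP e_ge0) _.
rewrite ler_pdivrMr ?exprn_gt0// [leRHS]mulrAC ler_pdivlMr; last by lra.
apply: le_trans (noise_or_drift_gain z_ge0 drift2 P_bounds fourth_le) _.
by apply: ler_wpM2r; [apply: sqr_ge0|lra].
Qed.

End InverseQuadratic.

Section Rounds.
Variable R : realType.

(* The largest slope with [slope * bias_fourth_cst R <= noise R / 8], as the fourth
   moment condition of [expect_inv_quadratic_contract] requires. *)
Definition slope : R := noise R / (8 * bias_fourth_cst R).
Definition contraction : R := 1 - slope * noise R / 5.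

Lemma bias_fourth_cst_ge : 512 <= bias_fourth_cst R.
Proof.
have : 0 <= 4 * 6 ^+ 2 * 4 ^+ 4 :> R by rewrite !mulr_ge0 ?exprn_ge0.
rewrite /bias_fourth_cst; move: (4 * _ * _) => c; lra.
Qed.

Lemma noise_bounds : 0 < noise R <= 1 / 200.
Proof.
have e_gt0 := expR_gt0 (-12 : R).
have e_le : expR (-12) <= 1 / 10 :> R.
  by rewrite expRN -div1r ler_pdivrMr ?expR_gt0//; have := expR_ge1Dx (12 : R); lra.
by rewrite /noise divr_gt0//=; lra.
Qed.

Lemma slope_bounds : 0 < slope <= 1 / 200 / 1000.
Proof.
have /andP[noise_gt0 noise_le] := noise_bounds; have cst_ge := bias_fourth_cst_ge.
have cst_gt0 : 0 < 8 * bias_fourth_cst R by lra.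
by rewrite /slope divr_gt0//= ler_pdivrMr//; lra.
Qed.

Lemma contraction_bounds : 0 <= contraction <= 1.
Proof.
have := noise_bounds; have := slope_bounds => /andP[s_gt0 s_le] /andP[v_gt0 v_le].
have : 0 <= slope * noise R by rewrite mulr_ge0 ?ltW.
have : slope * noise R <= 1 * 1 by rewrite ler_pM ?ltW//; lra.
by rewrite /contraction; lra.
Qed.

Section FixedSize.
Variable n : nat.
Hypothesis n_ge : (1000 <= n)%N.
Implicit Types (x : seq (option bool)) (B : {set 'I_n}) (T : nat).
Let n_gt0 : (0 < n)%N. Proof. exact: leq_trans n_ge. Qed.
Let N : R := n%:R.
Let N_gt0 : 0 < N. Proof. by rewrite ltr0n. Qed.
(* [1 - gamma] is the average of the thresholds of [populated] and [polarized]. *)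
Let gamma : R := 7 / 15.

Definition potential x : R := (1 + slope / N * bias R x ^+ 2)^-1.

Definition unsettled_potential x : R := (~~ polarized R n x)%:R * potential x.

Definition potential_range : R := 1 + slope * (4 / 25) * N.

Definition convergence_failure T (p : R) : R :=
  potential_range * (contraction ^+ T * p + T%:R * depolarization_error R n)
  + T%:R * depopulation_error R n.

Definition failure_bound T x : R :=
  convergence_failure T (unsettled_potential x) + (~~ populated R n x)%:R.

Let slope_N_ge0 : 0 <= slope / N.
Proof. by case/andP: slope_bounds => s_gt0 _; rewrite divr_ge0 ?ltW. Qed.

Lemma potential_bounds x : 0 <= potential x <= 1.
Proof.
have ge1 : 1 <= 1 + slope / N * bias R x ^+ 2 by rewrite lerDl mulr_ge0 ?sqr_ge0.
by rewrite /potential invr_ge0 invf_le1 ?ge1 ?andbT (le_trans ler01 ge1, lt_le_trans ltr01 ge1).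
Qed.

Lemma unsettled_potential_bounds x : 0 <= unsettled_potential x <= 1.
Proof.
rewrite /unsettled_potential; case: (~~ _); first by rewrite mul1r potential_bounds.
by rewrite mul0r lexx ler01.
Qed.

Lemma potential_range_ge1 : 1 <= potential_range.
Proof.
case/andP: slope_bounds => s_gt0 _.
by rewrite lerDl mulr_ge0 ?(ltW N_gt0)// mulr_ge0 ?(ltW s_gt0) ?divr_ge0.
Qed.

Lemma depolarization_error_ge0 : 0 <= depolarization_error R n.
Proof.
by rewrite divr_ge0 ?sqr_ge0// mulr_ge0 ?exprn_ge0// (le_trans _ bias_fourth_cst_ge).
Qed.

Lemma depopulation_error_ge0 : 0 <= depopulation_error R n.
Proof. by rewrite divr_ge0 ?(ltW N_gt0)// mulr_ge0 ?exprn_ge0. Qed.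

Lemma convergence_failure_ge0 T (p : R) : 0 <= p -> 0 <= convergence_failure T p.
Proof.
move=> p_ge0; have /andP[c_ge0 _] := contraction_bounds.
have range_ge0 := le_trans ler01 potential_range_ge1.
apply: addr_ge0; last exact: mulr_ge0 (ler0n _ _) depopulation_error_ge0.
apply: mulr_ge0 range_ge0 _; apply: addr_ge0 (mulr_ge0 (ler0n _ _) depolarization_error_ge0).
exact: mulr_ge0 (exprn_ge0 T c_ge0) p_ge0.
Qed.

Section OneRoundPotential.
Variables (B : {set 'I_n}) (x : seq (option bool)).
Hypothesis B_le : #|B|%:R <= 1 / 16 * n%:R :> R.
Hypothesis x_size : size x = n.
Hypothesis x_populated : populated R n x.
Let kernel := value_kernel R 6 3 B x.
Let kernelP : is_distr kernel. Proof. exact: is_distr_value_kernel. Qed.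

Lemma expect_kernel_potential_le :
  ~~ polarized R n x -> expect kernel potential <= contraction * potential x.
Proof.
move=> x_unpolarized; have /andP[s_gt0 s_le] := slope_bounds.
have sN_gt0 : 0 < slope / N by rewrite divr_gt0.
have variance_ge : noise R * N <= variance kernel (@bias R) by apply: bias_variance_ge.
apply: expect_inv_quadratic_contract => //.
- have -> : slope * noise R = slope / N * (noise R * N) by field; rewrite gt_eqF.
  by rewrite ler_pM2l.
- apply: le_trans (_ : slope / N * (100 * N) <= _).
    by rewrite ler_pM2l//; apply: bias_variance_le.
  by rewrite (_ : _ / N * _ = 100 * slope); [lra|field; rewrite gt_eqF].
- apply: le_trans (_ : (slope / N) ^+ 2 * (bias_fourth_cst R * N ^+ 2) <= _).
    by apply: ler_wpM2l; [apply: sqr_ge0|apply: bias_fourth_moment_le].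
  have slope_cst : slope * bias_fourth_cst R = noise R / 8.
    by rewrite /slope; field; rewrite gt_eqF// (lt_le_trans _ bias_fourth_cst_ge).
  have -> : (slope / N) ^+ 2 * (bias_fourth_cst R * N ^+ 2) =
      slope / N * (slope * bias_fourth_cst R * N) by field; rewrite gt_eqF.
  by rewrite slope_cst -[leRHS]mulrA ler_pM2l//; lra.
- have := norm_expect_bias_ge n_ge B_le x_size x_populated.
  by rewrite min_l// ltW// ltNge.
Qed.

Lemma expect_kernel_unsettled_potential_le :
  expect kernel unsettled_potential <=
  contraction * unsettled_potential x + depolarization_error R n.
Proof.
rewrite {2}/unsettled_potential.
have [x_polarized|x_unpolarized] := boolP (polarized R n x).
  rewrite mul0r mulr0 add0r.
  apply: le_trans (kernel_not_polarized_le n_ge B_le x_size x_populated x_polarized).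
  rewrite prob_expect; apply: ler_expect => // y; rewrite /unsettled_potential.
  by rewrite ler_piMr//; case/andP: (potential_bounds y).
rewrite mul1r -[leLHS]addr0 lerD ?depolarization_error_ge0//.
apply: le_trans (expect_kernel_potential_le x_unpolarized); apply: ler_expect => // y.
rewrite /unsettled_potential ler_piMl//; first by case/andP: (potential_bounds y).
by rewrite lern1 leq_b1.
Qed.

Lemma expect_kernel_failure_bound_le T :
  expect kernel (failure_bound T) <= failure_bound T.+1 x.
Proof.
have range_ge0 := le_trans ler01 potential_range_ge1.
have /andP[c_ge0 c_le1] := contraction_bounds.
rewrite {1}/failure_bound /convergence_failure 2!expectD (expectZ _ potential_range) expectD.
rewrite (expectZ _ (contraction ^+ T)) !expect_cst//.
have := kernel_not_populated_le n_ge B_le x_size x_populated.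
rewrite prob_expect -/kernel => populated_le.
have potential_le := ler_wpM2l (exprn_ge0 T c_ge0) expect_kernel_unsettled_potential_le.
have error_le : contraction ^+ T * depolarization_error R n <= depolarization_error R n.
  by rewrite ler_piMl ?depolarization_error_ge0 ?exprn_ile1.
rewrite mulrDr mulrA -exprSr in potential_le.
rewrite /failure_bound x_populated addr0 /convergence_failure -[T.+1%:R]natr1.
have := ler_wpM2l range_ge0 (lerD (le_trans potential_le (lerD (lexx _) error_le))
  (lexx (T%:R * depolarization_error R n))).
lra.
Qed.

End OneRoundPotential.

Definition agree x : bool :=
  [exists b : bool, (1 - gamma) * N <= (count_mem (Some b) x)%:R].

Lemma almost_agreeE (c : config n) x :
  size x = n -> (forall u : 'I_n, c.1 u = nth None x u) ->
  almost_agree gamma c = agree x.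
Proof.
move=> x_size c_x; apply: eq_existsb => b; congr (_ <= _%:R).
rewrite -sum1dep_card -sum1_count (big_nth None) x_size big_mkord.
by apply: eq_bigl => u; rewrite c_x.
Qed.

Lemma agree_polarized x : populated R n x -> polarized R n x -> agree x.
Proof.
rewrite /populated /polarized num_definedE biasE => pop; rewrite ler_normr => pol.
by apply/existsP; case/orP: pol => pol; [exists true|exists false]; rewrite /N /gamma; lra.
Qed.

Lemma potential_range_unpolarized x : ~~ polarized R n x -> 1 <= potential_range * potential x.
Proof.
rewrite -ltNge => /ltW small.
have bias2 : bias R x ^+ 2 <= (2 / 5 * N) ^+ 2.
  rewrite -[leLHS]real_normK ?num_real// lerXn2r ?nnegrE//.
  by rewrite mulr_ge0 ?divr_ge0 ?(ltW N_gt0).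
have Q_ge1 : 1 <= 1 + slope / N * bias R x ^+ 2 by rewrite lerDl mulr_ge0 ?sqr_ge0.
rewrite /potential ler_pdivlMr ?mul1r; last exact: lt_le_trans ltr01 Q_ge1.
rewrite lerD2l; have <- : slope / N * (2 / 5 * N) ^+ 2 = slope * (4 / 25) * N.
  by field; rewrite gt_eqF.
by rewrite ler_wpM2l.
Qed.

Lemma disagree_le_failure_bound0 x : (~~ agree x)%:R <= failure_bound 0 x.
Proof.
have /andP[up_ge0 _] := unsettled_potential_bounds x.
have cf_ge0 := convergence_failure_ge0 0 up_ge0.
have [_|disagree] := boolP (agree x); first by rewrite addr_ge0.
rewrite /failure_bound; have [pop|_] := boolP (populated R n x); last by rewrite lerDr.
have unpolarized : ~~ polarized R n x by apply: contra disagree; apply: agree_polarized.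
rewrite addr0 /convergence_failure /unsettled_potential unpolarized expr0 !mul0r !addr0 !mul1r.
exact: potential_range_unpolarized.
Qed.

(* The inboxes of a round are drawn after [adv h] is fixed, so sending and updating
   combine into the kernel; the cap at 1 covers the states with too few defined nodes. *)
Lemma run_disagree_le (adv : adversary n) T h x :
  eps_bounded (1 / 16 : R) adv -> size x = n ->
  expect (send_distr R n 6 x) (fun c => prob (run R 6 3 adv T h c)
    (fun c' => ~~ almost_agree gamma c')) <= Num.min 1 (failure_bound T x).
Proof.
move=> adv_le; elim: T h x => [|T IH] h x x_size.
  rewrite (@expect_send_values R n 6 n_gt0 x _ (~~ agree x)%:R)//.
    by rewrite le_min disagree_le_failure_bound0 andbT lern1 leq_b1.
  by move=> c c_x; rewrite prob_expect expect_ret (almost_agreeE x_size c_x).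
have kernelP := is_distr_value_kernel R 6 3 n_gt0 (adv h) x.
apply: (@le_trans _ _ (expect (value_kernel R 6 3 (adv h) x)
    (fun y => Num.min 1 (failure_bound T y)))).
  rewrite -expect_send_update//; apply: ler_expect => [|c]; first exact: is_distr_send.
  rewrite prob_expect [run _ _ _ _ _ _ _]/= expect_bind expect_round.
  apply: ler_expect_dseq => [u|y]; first exact: is_distr_value_distr.
  rewrite size_enum_ord => y_size; under eq_expect do rewrite -prob_expect.
  exact: IH.
rewrite le_min expect_le//=; last by move=> y; rewrite ge_min lexx.
have [x_populated|few] := boolP (populated R n x).
  apply: le_trans (expect_kernel_failure_bound_le (adv_le h) x_size x_populated T).
  by apply: ler_expect => // y; rewrite ge_min lexx orbT.
apply: (@le_trans _ _ 1); first by apply: expect_le => // y; rewrite ge_min lexx.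
rewrite /failure_bound few lerDr convergence_failure_ge0//.
by case/andP: (unsettled_potential_bounds x).
Qed.

Lemma process_almost_agree_ge (adv : adversary n) (x0 : 'I_n -> bool) T :
  eps_bounded (1 / 16 : R) adv ->
  1 - convergence_failure T 1 <= prob (process R 6 3 adv x0 T) (almost_agree gamma).
Proof.
move=> adv_le; set x := [seq Some (x0 u) | u <- enum 'I_n].
have x_size : size x = n by rewrite size_map size_enum_ord.
have x_defined : num_defined R x = N.
  rewrite /num_defined /value_sum big_map big_enum /=.
  by rewrite (eq_bigr (fun=> 1)) ?sumr_const ?card_ord.
have x_populated : populated R n x.
  by rewrite /populated x_defined ler_piMl ?(ltW N_gt0)//; lra.
have := run_disagree_le T [::] adv_le x_size; rewrite le_min => /andP[_ disagree_le].
have failure_le : failure_bound T x <= convergence_failure T 1.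
  have /andP[up_ge0 up_le1] := unsettled_potential_bounds x.
  have /andP[c_ge0 _] := contraction_bounds.
  rewrite /failure_bound x_populated addr0 lerD2r ler_wpM2l ?lerD2r ?ler_wpM2l ?exprn_ge0//.
  exact: le_trans ler01 potential_range_ge1.
rewrite lerBlDr -lerBlDl -prob_negb; last exact: is_distr_process.
apply: le_trans (le_trans disagree_le failure_le).
rewrite prob_expect /process expect_bind expect_init_config -/x.
by under eq_expect do rewrite -prob_expect.
Qed.

End FixedSize.
End Rounds.

Section LogarithmicTime.
Variable R : realType.

Definition rounds_cst : R := 10 / (slope R * noise R).

Definition num_rounds (n : nat) : nat := (Num.truncn (rounds_cst * ln n%:R)).+1.

Lemma contraction_gap_gt0 : 0 < slope R * noise R.
Proof.
by apply: mulr_gt0; [case/andP: (slope_bounds R)|case/andP: (noise_bounds R)].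
Qed.

Lemma rounds_cst_gt0 : 0 < rounds_cst.
Proof. by rewrite divr_gt0 ?contraction_gap_gt0. Qed.

Lemma num_rounds_ge n : rounds_cst * ln n%:R <= (num_rounds n)%:R.
Proof. exact/ltW/truncnS_gt. Qed.

Lemma num_rounds_le n : (0 < n)%N -> (num_rounds n)%:R <= rounds_cst * ln n%:R + 1.
Proof.
move=> n_gt0; rewrite -natr1 lerD2r truncn_le// mulr_ge0 ?(ltW rounds_cst_gt0)//.
by rewrite ln_ge0// ler1n.
Qed.

Lemma num_rounds_le_ln n : (1 < n)%N ->
  (num_rounds n)%:R <= (rounds_cst + (ln 2)^-1) * ln n%:R.
Proof.
move=> n_gt1; apply: le_trans (num_rounds_le (ltnW n_gt1)) _.
have ln2_gt0 : 0 < ln (2 : R) by rewrite ln_gt0// ltr1n.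
rewrite mulrDl lerD2l mulrC ler_pdivlMr// mul1r ler_ln ?posrE ?ltr0n ?(ltnW n_gt1)//.
by rewrite ler_nat.
Qed.

Lemma contraction_pow_num_rounds_le n : (0 < n)%N ->
  contraction R ^+ num_rounds n <= n%:R ^- 2.
Proof.
move=> n_gt0; set gap := slope R * noise R.
have gap_gt0 : 0 < gap := contraction_gap_gt0.
apply: (@le_trans _ _ (expR (- (gap / 5)) ^+ num_rounds n)).
  case/andP: (contraction_bounds R) => c_ge0 _.
  by rewrite lerXn2r ?nnegrE ?expR_ge0// (le_trans _ (expR_ge1Dx _)).
have lnK_n : expR (ln n%:R) = n%:R :> R by rewrite lnK// posrE ltr0n.
rewrite -expRM_natl -[in leRHS]lnK_n -exprVn -expRN -expRM_natl ler_expR.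
have := ler_wpM2l (ltW gap_gt0) (num_rounds_ge n).
have -> : gap * (rounds_cst * ln n%:R) = 10 * ln n%:R.
  by rewrite /rounds_cst -/gap; field; rewrite gt_eqF.
lra.
Qed.

(* The factor 2 comes from [potential_range R n <= 2 * n%:R]. *)
Definition error_cst : R := 2 * (25 ^+ 4 * bias_fourth_cst R) + 25 * 32 ^+ 2.

Lemma error_cst_ge0 : 0 <= error_cst.
Proof.
have c_ge0 : 0 <= bias_fourth_cst R := le_trans (ler0n _ 512) (bias_fourth_cst_ge R).
apply: addr_ge0; last by rewrite mulr_ge0 ?exprn_ge0.
by apply: mulr_ge0 => //; apply: mulr_ge0 c_ge0; rewrite exprn_ge0.
Qed.

Lemma convergence_failure_num_rounds_le n : (1000 <= n)%N ->
  convergence_failure n (num_rounds n) (1 : R) <=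
  (2 + (num_rounds n)%:R * error_cst) / n%:R.
Proof.
move=> n_ge; have n_gt0 : (0 < n)%N := leq_trans (isT : 0 < 1000)%N n_ge.
have N_ge1 : 1 <= n%:R :> R by rewrite ler1n.
have N_gt0 : 0 < n%:R :> R by rewrite ltr0n.
have range_le : potential_range R n <= 2 * n%:R.
  case/andP: (slope_bounds R) => s_gt0 s_le; rewrite mulr_natl mulr2n.
  by rewrite lerD// ler_piMl ?ltW//; lra.
set T := num_rounds n; set loss := depolarization_error R n.
have rate_le : contraction R ^+ T * 1 + T%:R * loss <= n%:R ^- 2 + T%:R * loss.
  by rewrite mulr1 lerD2r contraction_pow_num_rounds_le.
have rate_ge0 : 0 <= contraction R ^+ T * 1 + T%:R * loss.
  case/andP: (contraction_bounds R) => c_ge0 _.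
  rewrite mulr1; apply: addr_ge0 (mulr_ge0 (ler0n _ _) (depolarization_error_ge0 _ _)).
  exact: exprn_ge0.
apply: le_trans (lerD (ler_pM _ rate_ge0 range_le rate_le) (lexx _)) _.
  exact: le_trans ler01 (potential_range_ge1 R n_ge).
rewrite [leLHS](_ : _ = (2 + T%:R * error_cst) / n%:R)//.
by rewrite /loss /depolarization_error /depopulation_error /error_cst; field; rewrite gt_eqF.
Qed.

Lemma affine_ln_le_sqrt (a b : R) : 0 <= a -> 0 <= b ->
  exists n0, forall n : nat, (n0 <= n)%N -> a + b * ln n%:R <= Num.sqrt n%:R.
Proof.
move=> a_ge0 b_ge0; exists (Num.truncn ((a + 4 * b) ^+ 4)).+1 => n n_large.
have N_gt0 : 0 < n%:R :> R by rewrite ltr0n (leq_trans _ n_large).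
set r := Num.sqrt n%:R; set s := Num.sqrt r.
have s2 : s ^+ 2 = r by rewrite sqr_sqrtr// sqrtr_ge0.
have s4 : s ^+ 4 = n%:R by rewrite (exprM s 2 2) s2 sqr_sqrtr// ltW.
have s_gt0 : 0 < s by rewrite !sqrtr_gt0.
have r_ge1 : 1 <= r by rewrite -[1]sqrtr1 ler_wsqrtr// ler1n -(ltr0n R).
have s_ge1 : 1 <= s by rewrite -[1]sqrtr1 ler_wsqrtr.
have s_large : a + 4 * b <= s.
  rewrite -(@ler_pXn2r _ 4) ?nnegrE ?(ltW s_gt0) ?addr_ge0 ?mulr_ge0// s4.
  by apply/ltW/(lt_le_trans (truncnS_gt _)); rewrite ler_nat.
have ln_le : ln n%:R <= 4 * s.
  by rewrite -s4 lnXn// -[leLHS]mulr_natl ler_pM2l// ltW// ln_sublinear.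
apply: (@le_trans _ _ ((a + 4 * b) * s)); last by rewrite -s2 expr2 ler_pM2r.
have := ler_wpM2l b_ge0 ln_le; have := ler_wpM2l a_ge0 s_ge1; lra.
Qed.

Lemma convergence_failure_le_powR : exists n0, forall n, (n0 <= n)%N ->
  convergence_failure n (num_rounds n) (1 : R) <= n%:R `^ (- 2^-1).
Proof.
have K_ge0 := ltW rounds_cst_gt0; have e_ge0 := error_cst_ge0.
have a_ge0 : 0 <= 2 + error_cst by rewrite addr_ge0.
have [n0 ln_le] := affine_ln_le_sqrt a_ge0 (mulr_ge0 e_ge0 K_ge0).
exists (maxn 1000 n0) => n; rewrite geq_max => /andP[n_ge n_ge0].
have n_gt0 : (0 < n)%N := leq_trans (isT : 0 < 1000)%N n_ge.
have N_gt0 : 0 < n%:R :> R by rewrite ltr0n.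
apply: le_trans (convergence_failure_num_rounds_le n_ge) _.
have sqrt_gt0 : 0 < Num.sqrt n%:R :> R by rewrite sqrtr_gt0.
have sqr_sqrt_n : Num.sqrt n%:R * Num.sqrt n%:R = n%:R :> R by rewrite -expr2 sqr_sqrtr// ltW.
rewrite powRN powR12_sqrt ?(ltW N_gt0)// ler_pdivrMr//.
rewrite -[X in _ <= _ * X]sqr_sqrt_n mulKf ?gt_eqF//.
apply: le_trans (ln_le n n_ge0).
have := ler_wpM2r e_ge0 (num_rounds_le n_gt0); lra.
Qed.

End LogarithmicTime.

Theorem theorem1 (R : realType) (eps : R) :
  eps <= 1 / 16 ->
  exists (gamma C c : R) (n0 : nat),
    0 <= gamma < 1 / 2 /\ 0 < C /\ 0 < c /\
    forall n : nat, (n0 <= n)%N ->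
      exists T : nat, (T%:R : R) <= C * ln (n%:R : R) /\
        forall (x0 : 'I_n -> bool) (adv : adversary n),
          @eps_bounded R n eps adv ->
          1 - (n%:R : R) `^ (- c) <= prob (@process R n 6 3 adv x0 T) (@almost_agree R n gamma).
Proof.
move=> eps_le; have [n0 failure_le] := convergence_failure_le_powR R.
exists (7 / 15), (rounds_cst R + (ln 2)^-1), 2^-1, (maxn 1000 n0).
split; first lra.
split; first by rewrite addr_gt0 ?rounds_cst_gt0 ?invr_gt0 ?ln_gt0 ?ltr1n.
split; first by rewrite invr_gt0.
move=> n; rewrite geq_max => /andP[n_ge n_ge0]; exists (num_rounds R n).
split=> [|x0 adv adv_le]; first exact: num_rounds_le_ln (leq_trans _ n_ge).
have blocked_le : eps_bounded (1 / 16 : R) adv.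
  by move=> h; apply: le_trans (adv_le h) _; apply: ler_wpM2r eps_le.
apply: le_trans (process_almost_agree_ge n_ge x0 _ blocked_le).
by rewrite lerD2l lerN2 failure_le.
Qed.
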